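(* Let $\mathcal T$ be a $C^r$ local $T^n$-action on $X$, let $\{(U^X_\alpha,\varphi^X_\alpha)\}\in\mathcal T$ be a weakly standard atlas, and let $\{\rho_{\alpha\beta}\}$ be the associated Čech one-cocycle on the open cover $\{U^B_\alpha\}$ of the orbit space $B_X$ with values in $\mathrm{Aut}(T^n)$. Then $\mathcal T$ is induced by some $C^r$ locally standard $T^n$-action on $X$ if and only if $\{\rho_{\alpha\beta}\}$ is equivalent to the trivial Čech one-cocycle in $H^1(B_X;\mathrm{Aut}(T^n))$, where the trivial cocycle is the one all of whose values are the identity map of $T^n$.
   Context: $T^n=(S^1)^n$ acts on $\mathbb C^n$ by the standard representation $u\cdot z=(u_1z_1,\dots,u_nz_n)$. $\mathrm{Aut}(T^n)$ is the group of automorphisms of $T^n$; a map $f$ is $\rho$-equivariant if $f(u\cdot x)=\rho(u)\cdot f(x)$. Let $X$ be a compact Hausdorff space. A weakly standard $C^r$ atlas ($0\le r\le\infty$) of $X$ is an atlas $\{(U^X_\alpha,\varphi^X_\alpha)\}$ such that (i) each $\varphi^X_\alpha$ is a homeomorphism from $U^X_\alpha$ onto a $T^n$-invariant open subset of $\mathbb C^n$; (ii) on each nonempty overlap $U^X_{\alpha\beta}$ the images $\varphi^X_\alpha(U^X_{\alpha\beta})$, $\varphi^X_\beta(U^X_{\alpha\beta})$ are $T^n$-invariant and there is $\rho_{\alpha\beta}\in\mathrm{Aut}(T^n)$ such that $\varphi^X_{\alpha\beta}=\varphi^X_\alpha\circ(\varphi^X_\beta)^{-1}$ is a $\rho_{\alpha\beta}$-equivariant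 $C^r$ diffeomorphism (homeomorphism if $r=0$). Overlaps of two open sets are assumed connected. Two such atlases are equivalent if on each nonempty overlap the transition map is a $\rho$-equivariant $C^r$ diffeomorphism for some $\rho$. An equivalence class $\mathcal T$ is a $C^r$ local $T^n$-action on $X$. The orbit space $B_X$ is obtained by gluing the sets $U^B_\alpha:=\varphi^X_\alpha(U^X_\alpha)/T^n$ via the maps induced by the $\varphi^X_{\alpha\beta}$; the orbit map $\mu_X\colon X\to B_X$ is induced by the projections, and $U^X_\alpha=\mu_X^{-1}(U^B_\alpha)$. The $\rho_{\alpha\beta}$ form a Čech one-cocycle on $\{U^B_\alpha\}$ with values in $\mathrm{Aut}(T^n)$. Two cocycles $\{\rho_{\alpha\beta}\},\{\rho'_{\alpha\beta}\}$ on a cover are equivalent if there are $\rho_\alpha\in\mathrm{Aut}(T^n)$ with $\rho'_{\alpha\beta}=\rho_\alpha\circ\rho_{\alpha\beta}\circ\rho_\beta^{-1}$ on each overlap; $H^1(B_X;\mathrm{Aut}(T^n))$ is the direct limit over refinements of the sets of equivalence classes. A $C^r$ $T^n$-action on $X$ is locally standard if $X$ has an atlas (standard atlas) of triples $(U,\rho,\varphi)$ with $U\subset X$ a $T^n$-invariant open set, $\rho\in\mathrm{Aut}(T^n)$, and $\varphi$ a $\rho$-equivariant $C^r$ diffeomorphism from $U$ onto a $T^n$-invariant open subset of $\mathbb C^n$. A standard atlas is weakly standard; $\mathcal T$ is induced by the action if $\mathcal T$ is the class of its standard atlas. *)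

(* Defs.v *)
From HB Require Import structures.
From Stdlib Require Import Relation_Operators.
From mathcomp Require Import all_boot all_order all_algebra.
From mathcomp Require Import complex.
From mathcomp Require Import all_classical all_reals all_analysis.

Set Implicit Arguments.
Unset Strict Implicit.
Unset Printing Implicit Defensive.

Import Order.TTheory GRing.Theory Num.Theory.
Import numFieldNormedType.Exports.

Local Open Scope classical_set_scope.
Local Open Scope quotient_scope.
Local Open Scope ring_scope.

Section Cech.
Context (B : topologicalType) (G : groupType).

Record open_cover := OpenCover {
  cov_idx : Type;
  cov_set :> cov_idx -> set B;
  cov_open : forall i, open (cov_set i);
  cov_full : \bigcup_i cov_set i = setT }.

(* Only the values on nonempty overlaps are meaningful: the others are
   unconstrained, and [cocycle_equiv] ignores them. *)
Record cocycle (U : open_cover) := Cocycle {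
  cocycle_val :> cov_idx U -> cov_idx U -> G;
  cocycleP : forall i j k, U i `&` U j `&` U k !=set0 ->
    (cocycle_val i j * cocycle_val j k = cocycle_val i k)%g }.

Definition cocycle_equiv (U : open_cover) (c c' : cocycle U) : Prop :=
  exists a : cov_idx U -> G, forall i j, U i `&` U j !=set0 ->
    (c' i j = a i * c i j * (a j)^-1)%g.

Lemma trivial_cocycle_proof (U : open_cover) (i j k : cov_idx U) :
  U i `&` U j `&` U k !=set0 -> (1 * 1 = 1 :> G)%g.
Proof. by rewrite mulg1. Qed.

Definition trivial_cocycle (U : open_cover) : cocycle U :=
  Cocycle (@trivial_cocycle_proof U).

Record refinement (V U : open_cover) := Refinement {
  ref_map :> cov_idx V -> cov_idx U;
  ref_sub : forall i, V i `<=` U (ref_map i) }.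

Lemma restrict_cocycle_proof (V U : open_cover) (t : refinement V U)
    (c : cocycle U) i j k : V i `&` V j `&` V k !=set0 ->
  (c (t i) (t j) * c (t j) (t k) = c (t i) (t k))%g.
Proof.
case=> x [[Vi Vj] Vk]; apply: cocycleP.
by exists x; split; [split|]; exact: (@ref_sub _ _ t).
Qed.

Definition restrict_cocycle V U (t : refinement V U) (c : cocycle U) :
  cocycle V := Cocycle (restrict_cocycle_proof t c).

Definition cech_pair := {U : open_cover & cocycle U}.

(* Two cocycles, possibly on different covers, define the same element of the
   direct limit when they become equivalent on a common refinement. *)
Definition cech_equal (x y : cech_pair) : Prop :=
  exists (V : open_cover) (s : refinement V (projT1 x))
         (t : refinement V (projT1 y)),
    cocycle_equiv (restrict_cocycle s (projT2 x))
                  (restrict_cocycle t (projT2 y)).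

Definition cech_H1 := {K : cech_pair -> Prop | exists x, K = cech_equal x}.

Definition cech_class (U : open_cover) (c : cocycle U) : cech_H1 :=
  exist _ (cech_equal (existT _ U c)) (ex_intro _ (existT _ U c) erefl).

End Cech.

(* Maps of class C^r: [Some k] stands for C^k and [None] for C^oo. *)
Section Cr.
Context (R : realType) (V W : normedModType R).

Fixpoint Ck (k : nat) (U : set V) (f : V -> W) : Prop :=
  match k with
  | 0 => forall x, U x -> {for x, continuous f}
  | k'.+1 => (forall x, U x -> differentiable f x) /\
             forall v, Ck k' U (fun x => 'D_v f x)
  end.

(* Meant for open [U]. *)
Definition Cr (r : option nat) (U : set V) (f : V -> W) : Prop :=
  match r with
  | Some k => Ck k U f
  | None => forall k, Ck k U f
  end.

End Cr.

(* A left inverse defined on all of [Y] need not exist when [X] is empty,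
   hence the inverse [g] is only defined on [V]. *)
Definition homeomorphism_on (X Y : topologicalType) (U : set X) (V : set Y)
    (f : X -> Y) : Prop :=
  [/\ set_bij U V f, {within U, continuous f} &
      exists2 g : set_type V -> X, continuous g &
        forall y, U (g y) /\ f (g y) = \val y].

HB.instance Definition _ (R : realType) := PseudoPointedMetric.copy R[i] R[i]^o.
HB.instance Definition _ (R : realType) := NormedModule.copy R[i] R[i]^o.

Notation Cn R n := 'rV[R[i]]_n.

Section Torus.
Context (R : realType) (n : nat).

Definition torus_set : set (Cn R n) := [set u | forall k, `|u ord0 k| = 1].
Definition torus := set_type torus_set.

HB.instance Definition _ := Topological.on torus.

Definition mk_torus (z : Cn R n) (hz : forall k, `|z ord0 k| = 1) : torus :=
  exist (fun z => z \in torus_set) z (mem_set hz).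

Lemma torusP (u : torus) k : `|\val u ord0 k| = 1.
Proof. by case: u => u /= /set_mem; apply. Qed.

Lemma torus_ext (u v : torus) :
  (forall k, \val u ord0 k = \val v ord0 k) -> u = v.
Proof. by move=> uv; apply/val_inj/rowP. Qed.

Lemma torus_one_proof k : `|(\row_(j < n) 1 : Cn R n) ord0 k| = 1.
Proof. by rewrite mxE normr1. Qed.

Lemma torus_mul_proof (u v : torus) k :
  `|(\row_j (\val u ord0 j * \val v ord0 j) : Cn R n) ord0 k| = 1.
Proof. by rewrite mxE normrM !torusP mulr1. Qed.

Lemma torus_inv_proof (u : torus) k :
  `|(\row_j (\val u ord0 j)^-1 : Cn R n) ord0 k| = 1.
Proof. by rewrite mxE normfV torusP invr1. Qed.

Definition torus_one : torus := mk_torus torus_one_proof.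
Definition torus_mul (u v : torus) : torus := mk_torus (torus_mul_proof u v).
Definition torus_inv (u : torus) : torus := mk_torus (torus_inv_proof u).

Lemma torus_mulA : associative torus_mul.
Proof. by move=> u v w; apply: torus_ext => k; rewrite !mxE mulrA. Qed.

Lemma torus_mul1 : left_id torus_one torus_mul.
Proof. by move=> u; apply: torus_ext => k; rewrite !mxE mul1r. Qed.

Lemma torus_mulr1 : right_id torus_one torus_mul.
Proof. by move=> u; apply: torus_ext => k; rewrite !mxE mulr1. Qed.

Lemma torus_neq0 (u : torus) k : \val u ord0 k != 0.
Proof. by rewrite -normr_eq0 torusP oner_eq0. Qed.

Lemma torus_mulV : left_inverse torus_one torus_inv torus_mul.
Proof.
by move=> u; apply: torus_ext => k; rewrite !mxE mulVf // torus_neq0.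
Qed.

Lemma torus_mulrV : right_inverse torus_one torus_inv torus_mul.
Proof.
by move=> u; apply: torus_ext => k; rewrite !mxE mulfV // torus_neq0.
Qed.

HB.instance Definition _ := isGroup.Build torus
  torus_mulA torus_mul1 torus_mulr1 torus_mulV torus_mulrV.

Record torus_aut := TorusAut {
  aut_fun :> torus -> torus;
  aut_inv : torus -> torus;
  autM : forall u v, aut_fun (u * v)%g = (aut_fun u * aut_fun v)%g;
  autK : cancel aut_fun aut_inv;
  autVK : cancel aut_inv aut_fun;
  aut_continuous : continuous aut_fun;
  autV_continuous : continuous aut_inv }.

HB.instance Definition _ := gen_eqMixin torus_aut.
HB.instance Definition _ := gen_choiceMixin torus_aut.

Lemma torus_aut_ext (f g : torus_aut) : f =1 g -> f = g.
Proof.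
case: f g => [f f' fM fK fVK fc fVc] [g g' gM gK gVK gc gVc] /= fg.
have {}fg : f = g by apply: funext.
subst g; have ff' : f' = g' by apply: funext => u; rewrite -[in RHS](fVK u) gK.
by subst g'; congr TorusAut; exact: Prop_irrelevance.
Qed.

Definition aut_one : torus_aut.
Proof. by exists id id => // u; exact: cvg_id. Defined.

Definition aut_comp (f g : torus_aut) : torus_aut.
Proof.
exists (f \o g) (aut_inv g \o aut_inv f).
- by move=> u v /=; rewrite !autM.
- by move=> u /=; rewrite !autK.
- by move=> u /=; rewrite !autVK.
- move=> u; apply: continuous_comp; exact: aut_continuous.
- move=> u; apply: continuous_comp; exact: autV_continuous.
Defined.

Definition aut_inverse (f : torus_aut) : torus_aut.
Proof.
exists (aut_inv f) f.
- by move=> u v; rewrite -{1}(autVK f u) -{1}(autVK f v) -autM autK.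
- exact: autVK.
- exact: autK.
- exact: autV_continuous.
- exact: aut_continuous.
Defined.

Lemma aut_compA : associative aut_comp.
Proof. by move=> f g h; apply: torus_aut_ext. Qed.

Lemma aut_comp1 : left_id aut_one aut_comp.
Proof. by move=> f; apply: torus_aut_ext. Qed.

Lemma aut_compr1 : right_id aut_one aut_comp.
Proof. by move=> f; apply: torus_aut_ext. Qed.

Lemma aut_compV : left_inverse aut_one aut_inverse aut_comp.
Proof. by move=> f; apply: torus_aut_ext => u /=; rewrite autK. Qed.

Lemma aut_comprV : right_inverse aut_one aut_inverse aut_comp.
Proof. by move=> f; apply: torus_aut_ext => u /=; rewrite autVK. Qed.

HB.instance Definition _ := isGroup.Build torus_aut
  aut_compA aut_comp1 aut_compr1 aut_compV aut_comprV.

Definition std_act (u : torus) (z : Cn R n) : Cn R n :=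
  \row_k (\val u ord0 k * z ord0 k).

Definition torus_invariant (W : set (Cn R n)) : Prop :=
  forall u z, W z -> W (std_act u z).

Lemma std_act1 z : std_act 1%g z = z.
Proof. by apply/rowP => k; rewrite !mxE mul1r. Qed.

Lemma std_actM u v z : std_act (u * v)%g z = std_act u (std_act v z).
Proof. by apply/rowP => k; rewrite !mxE mulrA. Qed.

Lemma std_actK u z : std_act u^-1%g (std_act u z) = z.
Proof. by rewrite -std_actM mulVg std_act1. Qed.

Definition realify (z : Cn R n) : 'rV[R]_(n + n) :=
  row_mx (map_mx (@complex.Re R) z) (map_mx (@complex.Im R) z).

Definition complexify (x : 'rV[R]_(n + n)) : Cn R n :=
  \row_k Complex (lsubmx x ord0 k) (rsubmx x ord0 k).

Definition Cr_diffeo (r : option nat) (U V : set (Cn R n))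
    (f : Cn R n -> Cn R n) : Prop :=
  exists g : Cn R n -> Cn R n,
    [/\ set_bij U V f, {in U, cancel f g},
        Cr r (realify @` U) (realify \o f \o complexify) &
        Cr r (realify @` V) (realify \o g \o complexify)].

(* T^n = R^n / (2 pi Z)^n as a smooth manifold. *)
Lemma expi_proof (t : 'rV[R]_n) k :
  `|(\row_j Complex (cos (t ord0 j)) (sin (t ord0 j)) : Cn R n) ord0 k| = 1.
Proof. by rewrite mxE normc_def /= cos2Dsin2 sqrtr1. Qed.

Definition expi (t : 'rV[R]_n) : torus := mk_torus (expi_proof t).

(* The chart is the restriction of [cfun] to [cdom]; the values of [cfun]
   outside [cdom] are irrelevant. *)
Record chart (X : Type) := Chart {
  cdom : set X;
  cfun :> X -> Cn R n }.

Definition overlap X (c d : chart X) : set X := cdom c `&` cdom d.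

Definition cimg X (c : chart X) : set (Cn R n) := c @` cdom c.

Definition is_chart (X : topologicalType) (c : chart X) : Prop :=
  [/\ open (cdom c), open (cimg c) & homeomorphism_on (cdom c) (cimg c) c].

(* [c \o f \o d^-1], with junk value [0] where this makes no sense. *)
Definition local_rep X (c d : chart X) (f : X -> X) : Cn R n -> Cn R n :=
  fun z => xget 0 [set c (f x) |
                   x in [set x | [/\ cdom d x, cdom c (f x) & d x = z]]].

Definition transition X (c d : chart X) : Cn R n -> Cn R n := local_rep c d id.

Definition equivariant_diffeo X (r : option nat) (rho : torus_aut)
    (c d : chart X) : Prop :=
  [/\ torus_invariant (c @` overlap c d), torus_invariant (d @` overlap c d),
      forall u z, (d @` overlap c d) z ->
        transition c d (std_act u z) = std_act (rho u) (transition c d z) &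
      Cr_diffeo r (d @` overlap c d) (c @` overlap c d) (transition c d)].

(* The index type is a [choiceType] only because the library puts a topology on
   [{i : I & T i}] in that case. *)
Record ws_atlas (r : option nat) (X : topologicalType) := WsAtlas {
  ws_idx : choiceType;
  ws_chart :> ws_idx -> chart X;
  ws_cover : \bigcup_i cdom (ws_chart i) = setT;
  ws_is_chart : forall i, is_chart (ws_chart i);
  ws_invariant : forall i, torus_invariant (cimg (ws_chart i));
  ws_connected : forall i j, i != j ->
    connected (overlap (ws_chart i) (ws_chart j));
  ws_compatible : forall i j, overlap (ws_chart i) (ws_chart j) !=set0 ->
    exists rho, equivariant_diffeo r rho (ws_chart i) (ws_chart j) }.

Arguments ws_atlas : clear implicits.

Definition atlas_equiv r X (A B : ws_atlas r X) : Prop :=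
  forall (i : ws_idx A) (j : ws_idx B), overlap (A i) (B j) !=set0 ->
    exists rho, equivariant_diffeo r rho (A i) (B j).

(* [atlas_equiv] is transitive only as long as the overlaps between charts of
   different atlases are connected, so classes are taken with respect to the
   equivalence relation which it generates. *)
Definition atlas_class r X (A : ws_atlas r X) : ws_atlas r X -> Prop :=
  clos_refl_sym_trans _ (@atlas_equiv r X) A.

Definition local_torus_action r X (TT : ws_atlas r X -> Prop) : Prop :=
  exists A, TT = atlas_class A.

Definition associated r X (A : ws_atlas r X)
    (rho : ws_idx A -> ws_idx A -> torus_aut) : Prop :=
  forall i j, overlap (A i) (A j) !=set0 ->
    equivariant_diffeo r (rho i j) (A i) (A j).

Record torus_action (X : topologicalType) := TorusAction {
  act :> torus -> X -> X;
  act1 : forall x, act 1%g x = x;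
  actM : forall u v x, act (u * v)%g x = act u (act v x);
  act_continuous : continuous (fun p : torus * X => act p.1 p.2) }.

Definition Cr_structure (r : option nat) (X : topologicalType) (I : Type)
    (M : I -> chart X) : Prop :=
  [/\ \bigcup_i cdom (M i) = setT, forall i, is_chart (M i) &
      forall i j, Cr_diffeo r (M j @` overlap (M i) (M j))
        (M i @` overlap (M i) (M j)) (transition (M i) (M j))].

(* The action map T^n * X -> X is of class C^r, where T^n is parametrized
   by [expi] and X by the charts of [M]. *)
Definition Cr_action (r : option nat) (X : topologicalType) (I : Type)
    (M : I -> chart X) (a : torus_action X) : Prop :=
  forall i j, Cr r
    [set p : 'rV[R]_n * 'rV[R]_(n + n) | exists x,
      [/\ cdom (M j) x, cdom (M i) (a (expi p.1) x) & M j x = complexify p.2]]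
    (fun p => realify (local_rep (M i) (M j) (a (expi p.1)) (complexify p.2))).

Definition standard_atlas (r : option nat) (X : topologicalType) (I : Type)
    (M : I -> chart X) (a : torus_action X) (S : ws_atlas r X)
    (sigma : ws_idx S -> torus_aut) : Prop :=
  forall i,
    [/\ forall u x, cdom (S i) x -> cdom (S i) (a u x),
        forall u x, cdom (S i) x -> S i (a u x) = std_act (sigma i u) (S i x) &
        forall k, Cr_diffeo r (M k @` overlap (S i) (M k))
          (S i @` overlap (S i) (M k)) (transition (S i) (M k))].

Definition locally_standard (r : option nat) (X : topologicalType) (I : Type)
    (M : I -> chart X) (a : torus_action X) : Prop :=
  exists (S : ws_atlas r X) (sigma : ws_idx S -> torus_aut),
    standard_atlas M a sigma.

Definition induced_by (r : option nat) (X : topologicalType)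
    (TT : ws_atlas r X -> Prop) (I : Type) (M : I -> chart X)
    (a : torus_action X) : Prop :=
  exists (S : ws_atlas r X) (sigma : ws_idx S -> torus_aut),
    standard_atlas M a sigma /\ TT = atlas_class S.

Section Orbits.
Context (W : set (Cn R n)).

Definition orbit_rel (z w : set_type W) : bool :=
  `[< exists u, \val w = std_act u (\val z) >].

Lemma orbit_rel_refl : reflexive orbit_rel.
Proof. by move=> z; apply/asboolP; exists 1%g; rewrite std_act1. Qed.

Lemma orbit_rel_sym : symmetric orbit_rel.
Proof.
move=> z w; apply/asboolP/asboolP => -[u e]; exists u^-1%g;
  by rewrite e std_actK.
Qed.

Lemma orbit_rel_trans : transitive orbit_rel.
Proof.
move=> w z t /asboolP[u e] /asboolP[v e']; apply/asboolP.
by exists (v * u)%g; rewrite std_actM -e.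
Qed.

Canonical orbit_equiv :=
  EquivRel orbit_rel orbit_rel_refl orbit_rel_sym orbit_rel_trans.

Definition orbits := {eq_quot orbit_equiv}.

HB.instance Definition _ := Quotient.on orbits.
HB.instance Definition _ := Topological.copy orbits (quotient_topology orbits).

End Orbits.

Section Gluing.
Context (r : option nat) (X : topologicalType) (A : ws_atlas r X).

Definition orbit_pieces := {i : ws_idx A & orbits (cimg (A i))}.

HB.instance Definition _ := Topological.on orbit_pieces.

(* [glue_step a b]: the map of orbit spaces induced by the transition map sends
   the orbit [b] to the orbit [a]. *)
Definition glue_step (a b : orbit_pieces) : Prop :=
  exists (x : X) (z : set_type (cimg (A (projT1 a))))
         (w : set_type (cimg (A (projT1 b)))),
  [/\ overlap (A (projT1 a)) (A (projT1 b)) x,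
      A (projT1 a) x = \val z /\ A (projT1 b) x = \val w,
      projT2 a = \pi_(orbits _) z & projT2 b = \pi_(orbits _) w].

Definition glue_rel (a b : orbit_pieces) : bool :=
  `[< clos_refl_sym_trans _ glue_step a b >].

Lemma glue_rel_refl : reflexive glue_rel.
Proof. by move=> a; apply/asboolP/rst_refl. Qed.

Lemma glue_rel_sym : symmetric glue_rel.
Proof. by move=> a b; apply/asboolP/asboolP; exact: rst_sym. Qed.

Lemma glue_rel_trans : transitive glue_rel.
Proof.
by move=> b a c /asboolP ab /asboolP bc; apply/asboolP; exact: rst_trans bc.
Qed.

Canonical glue_equiv :=
  EquivRel glue_rel glue_rel_refl glue_rel_sym glue_rel_trans.

Definition orbit_space := {eq_quot glue_equiv}.

HB.instance Definition _ := Quotient.on orbit_space.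
HB.instance Definition _ :=
  Topological.copy orbit_space (quotient_topology orbit_space).

(* The open set U^B_i, seen inside the orbit space. *)
Definition orbit_chart_dom (i : ws_idx A) : set orbit_space :=
  range (fun p => \pi_orbit_space (existT _ i p)).


Lemma chart_inj i x y : cdom (A i) x -> cdom (A i) y -> A i x = A i y -> x = y.
Proof.
move=> Ux Uy; have [_ _ [[_ inj _] _ _]] := ws_is_chart (w := A) i.
by apply: inj; rewrite inE.
Qed.

Lemma transitionE i j x : overlap (A i) (A j) x ->
  transition (A i) (A j) (A j x) = A i x.
Proof.
move=> [Ui Uj]; rewrite /transition /local_rep.
case: xgetP => [_ -> [y [Vy _ e] <-]|/(_ (A i x))[]].
  by rewrite (chart_inj Vy Uj e).
by exists x.
Qed.

Lemma overlap_invariant i j u x : overlap (A i) (A j) x ->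
  exists2 y, overlap (A i) (A j) y & A j y = std_act u (A j x).
Proof.
move=> Ox; have [|rho [_ inv _ _]] := ws_compatible (w := A) (i := i) (j := j).
  by exists x.
have [y Oy e] : (A j @` overlap (A i) (A j)) (std_act u (A j x)).
  by apply: inv; exists x.
by exists y.
Qed.

Definition to_cimg i x (Ux : cdom (A i) x) : set_type (cimg (A i)) :=
  exist (fun z => z \in cimg (A i)) (A i x)
    (mem_set (ex_intro2 _ _ x Ux erefl)).

Lemma orbits_eqP i (z w : set_type (cimg (A i))) :
  \pi_(orbits (cimg (A i))) z = \pi_(orbits (cimg (A i))) w <->
  exists u, \val w = std_act u (\val z).
Proof.
split=> [/eqquotP/asboolP//|h]; apply/eqquotP; exact/asboolP.
Qed.

Lemma glue_relP a b : glue_rel a b <-> glue_step a b.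
Proof.
split=> [/asboolP|ab]; last by apply/asboolP; exact: rst_step.
elim=> {a b} [//|[i p]|a b _ [x [z [w [[Ux Uy] [ez ew] ea eb]]]]|
              [i p] [j q] [k s] _ + _ +].
- have [z <-] : exists z, \pi_(orbits _) z = p by exists (repr p); rewrite reprK.
  have [x Ux e] : cimg (A i) (\val z) by case: (z) => z0 /= /set_mem.
  by exists x, z, z; split.
- by exists x, w, z.
- move=> [x [z [w [/= [Uix Ujx] [ez ew] ep eq]]]].
  move=> [x' [z' [w' [/= [Ujx' Ukx'] [ez' ew'] eq' es]]]].
  have /orbits_eqP[u euz] : \pi_(orbits _) w = \pi_(orbits _) z'.
    by rewrite -eq -eq'.
  have {}euz : A j x' = std_act u (A j x) by rewrite ez' ew; exact: euz.
  have Oijx : overlap (A i) (A j) x by [].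
  have [y Oy ey] := overlap_invariant u Oijx.
  have yx' : y = x' by apply: (@chart_inj j) => //; [case: Oy|rewrite ey].
  subst y; have [Uix' _] := Oy.
  exists x', (to_cimg Uix'), w'; split => //=.
  rewrite ep; apply/orbits_eqP.
  have [|rho [_ _ eqv _]] := ws_compatible (w := A) (i := i) (j := j).
    by exists x.
  exists (rho u); rewrite -[\val (to_cimg _)]/(A i x') -(transitionE Oy) euz eqv; last by exists x.
  by rewrite (transitionE Oijx) ez.
Qed.

Lemma orbit_space_eqP (a b : orbit_pieces) :
  \pi_orbit_space a = \pi_orbit_space b <-> glue_step a b.
Proof.
rewrite -glue_relP; split=> [/eqquotP//|h]; exact/eqquotP.
Qed.

Lemma orbit_chart_domP i j x z (Ujx : cdom (A j) x) (ez : \val z = A j x) :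
  orbit_chart_dom i (\pi_orbit_space (existT _ j (\pi_(orbits _) z))) <->
  cdom (A i) x.
Proof.
split=> [[p _ /orbit_space_eqP[y [z' [w [/= Oy [_ ew] _]]]]]|Uix].
  move=> /orbits_eqP[u e]; have [x' [Uix' Ujx'] ex'] := overlap_invariant u^-1%g Oy.
  suff <- : x' = x by [].
  by apply: (chart_inj Ujx' Ujx); rewrite ex' ew e std_actK.
exists (\pi_(orbits _) (to_cimg Uix)) => //; apply/orbit_space_eqP.
by exists x, (to_cimg Uix), z; split => //=; split.
Qed.

Lemma orbit_chart_dom_open i : open (orbit_chart_dom i).
Proof.
apply/sigT_openP => j.
have [_ _ [_ _ [g gc gP]]] := ws_is_chart (w := A) j.
have [oUi _ _] := ws_is_chart (w := A) i.
suff e : \pi_(orbits _) @^-1` (existT _ j @^-1`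
    (\pi_orbit_space @^-1` orbit_chart_dom i)) = g @^-1` cdom (A i).
  rewrite /open/= /quotient_open e.
  by move/continuousP: gc; apply.
by apply/seteqP; split=> z /=; have [Ujg /esym eg] := gP z;
  rewrite (orbit_chart_domP _ Ujg eg).
Qed.

Lemma orbit_chart_repr k (q : orbit_space) : orbit_chart_dom k q ->
  exists x (z : set_type (cimg (A k))), [/\ cdom (A k) x, \val z = A k x &
    q = \pi_orbit_space (existT _ k (\pi_(orbits _) z))].
Proof.
move=> [p _ <-].
have [x Ux e] : cimg (A k) (\val (repr p)) by case: (repr p) => z /= /set_mem.
by exists x, (repr p); rewrite reprK.
Qed.

Lemma orbit_chart_dom_cover : \bigcup_i orbit_chart_dom i = setT.
Proof.
apply/seteqP; split=> // q _; case e : (repr q) => [i p]; exists i => //.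
by exists p => //; rewrite -e reprK.
Qed.

Definition orbit_cover : open_cover orbit_space :=
  OpenCover orbit_chart_dom_open orbit_chart_dom_cover.

Lemma chart_image_open i (O : set X) : open O -> O `<=` cdom (A i) ->
  open (A i @` O).
Proof.
move=> oO OU; have [_ oV [_ _ [g gc gP]]] := ws_is_chart (w := A) i.
have : open (g @^-1` O) by move/continuousP: gc; apply.
move=> [W oW eW].
suff -> : A i @` O = W `&` cimg (A i) by exact: openI.
apply/seteqP; split=> z.
  move=> [x Ox <-]; have Ux := OU _ Ox; split; last by exists x.
  have [Ug eg] := gP (to_cimg Ux).
  have gx : g (to_cimg Ux) = x by apply: (chart_inj Ug Ux).
  by have : (set_val @^-1` W) (to_cimg Ux) by rewrite eW /= gx.
move=> [Wz [x Ux e]]; have [Ug eg] := gP (to_cimg Ux).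
have gx : g (to_cimg Ux) = x by apply: (chart_inj Ug Ux).
exists x => //; rewrite -gx.
suff : (set_val @^-1` W) (to_cimg Ux) by rewrite eW.
by rewrite -e in Wz.
Qed.

Lemma open_free (W : set (Cn R n)) : open W -> W !=set0 ->
  exists2 z, W z & forall k, z ord0 k != 0.
Proof.
move=> oW [z Wz].
pose w : Cn R n := \row_k (z ord0 k == 0)%:R.
have sc : continuous (fun t : R[i] => t *: w : Cn R n).
  exact: scalel_continuous.
have /(cvgD (cvg_cst z)) fc := sc 0.
have /fc : nbhs (z + 0 *: w) W.
  by rewrite scale0r addr0; exact: open_nbhs_nbhs.
rewrite nbhs_simpl => /nbhs_ballP[e /= e0 he].
exists (z + (e / 2) *: w).
  apply: he; rewrite -ball_normE /ball_/= sub0r normrN gtr0_norm ?divr_gt0//.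
  by rewrite ltr_pdivrMr// ltr_pMr// ltr1n.
move=> k; rewrite !mxE; have [->|zk] := eqVneq (z ord0 k) 0.
  by rewrite add0r mulr1 gt_eqF// divr_gt0.
by rewrite mulr0 addr0.
Qed.

Lemma atlas_cocycle_proof rho (h : associated (A := A) rho) i j k :
  orbit_cover i `&` orbit_cover j `&` orbit_cover k !=set0 ->
  (rho i j * rho j k = rho i k)%g.
Proof.
case=> q [[qi qj] /orbit_chart_repr[x [z [Ukx ez eq]]]].
have Uix : cdom (A i) x by apply/(orbit_chart_domP i Ukx ez); rewrite -eq.
have Ujx : cdom (A j) x by apply/(orbit_chart_domP j Ukx ez); rewrite -eq.
pose O := cdom (A i) `&` cdom (A j) `&` cdom (A k).
have [oi _ _] := ws_is_chart (w := A) i.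
have [oj _ _] := ws_is_chart (w := A) j.
have [ok _ _] := ws_is_chart (w := A) k.
have oO : open (A k @` O).
  by apply: chart_image_open => [|? []//]; apply: openI => //; exact: openI.
have [|_ [y [[Uiy Ujy] Uky] <-] yfree] := open_free oO.
  by exists (A k x); exists x.
have Oij : overlap (A i) (A j) y by [].
have Oik : overlap (A i) (A k) y by [].
have Ojk : overlap (A j) (A k) y by [].
have [_ _ hij _] := h _ _ (ex_intro _ _ Oij).
have [_ _ hik _] := h _ _ (ex_intro _ _ Oik).
have [_ _ hjk _] := h _ _ (ex_intro _ _ Ojk).
have orb u : exists yu, [/\ overlap (A i) (A j) yu,
    A k yu = std_act u (A k y), A j yu = std_act (rho j k u) (A j y),
    A i yu = std_act (rho i k u) (A i y) &
    A i yu = std_act (rho i j (rho j k u)) (A i y)].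
  have [yu Oiku eu] := overlap_invariant u Oik.
  have [yu' Ojku eu'] := overlap_invariant u Ojk.
  have e : yu' = yu.
    by apply: (@chart_inj k); [case: Ojku|case: Oiku|rewrite eu eu'].
  subst yu'.
  have ej : A j yu = std_act (rho j k u) (A j y).
    rewrite -(transitionE Ojku) eu hjk; last by exists y.
    by rewrite (transitionE Ojk).
  have Oiju : overlap (A i) (A j) yu by case: Oiku; case: Ojku.
  exists yu; split=> //.
    rewrite -(transitionE Oiku) eu hik; last by exists y.
    by rewrite (transitionE Oik).
  rewrite -(transitionE Oiju) ej hij; last by exists y.
  by rewrite (transitionE Oij).
have free u v : std_act (rho i k u) (A i y) = std_act (rho i k v) (A i y) ->
    u = v.
  have [yu [[Uiu _] ku _ <- _]] := orb u.
  have [yv [[Uiv _] kv _ <- _]] := orb v.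
  move/(chart_inj Uiu Uiv) => e; subst yv; apply: torus_ext => l.
  move: ku; rewrite kv => /rowP/(_ l); rewrite !mxE.
  by move/(mulIf (yfree l)).
apply: torus_aut_ext => u /=.
have [yu [_ _ _ e1 e2]] := orb u.
rewrite -[rho i j _](autVK (rho i k)); congr (rho i k _).
by apply: free; rewrite autVK -e1 -e2.
Qed.

Definition atlas_cocycle rho (h : associated (A := A) rho) :
  cocycle torus_aut orbit_cover := Cocycle (atlas_cocycle_proof h).

End Gluing.
End Torus.

(* Main.v *)
From HB Require Import structures.
From Stdlib Require Import Relation_Operators.
Require Import Defs.
From mathcomp Require Import all_boot all_order all_algebra.
From mathcomp Require Import complex.
From mathcomp Require Import all_classical all_reals all_analysis.
From mathcomp Require Import ring lra.

Set Implicit Arguments.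
Unset Strict Implicit.
Unset Printing Implicit Defensive.

Import Order.TTheory GRing.Theory Num.Theory.
Import numFieldNormedType.Exports.

Local Open Scope classical_set_scope.
Local Open Scope quotient_scope.
Local Open Scope ring_scope.

(** On the overlap of two charts [A i] and [A j], moving a point by [u] as seen
    in [A j] moves it by [rho i j u] as seen in [A i].  An action of the torus
    on [X] which is standard in the charts amounts to a choice, for each chart
    and locally constantly on it, of an automorphism [tau] through which the
    torus acts there, these choices being matched by the [rho i j].  Such a
    family is a 0-cochain with coboundary [rho] on some refinement of the cover
    of the orbit space, which is what triviality in the direct limit means.

    From an action to a trivialization.  The standard atlas [S] of the action is
    only linked to [A] by a chain of equivalent atlases, and charts of atlases
    which are not consecutive in the chain may have disconnected overlaps, with
    different automorphisms on different components.  But equivariance near a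
    point does compose and can be inverted ([atlas_class_near]), so every point
    has an invariant open neighbourhood on which a chart of [A] is equivariant,
    through some automorphism, for the action.  The images in the orbit space of
    these patches are a cover on which [rho] becomes a coboundary
    ([patch_transition]): the automorphisms are compared at a point with trivial
    stabilizer, and such points are dense.

    From a trivialization to an action.  The trivialization distributes over
    the charts a locally constant, orbit invariant automorphism, recorded as a
    [framing] ([cech_trivial_framing]).  Letting [u] act in the chart [A i] as
    the automorphism prescribed there is then independent of [i]
    ([framed_translate]) and defines a continuous action.  Cutting each chart of
    [A] into the open sets on which its automorphism is constant yields a
    standard atlas equivalent to [A] ([framed_atlas]): the overlap of two
    different charts of [A] is connected, so that it is never cut into several
    pieces.

    Regularity of the action.  In the charts the action is
    [(t, y) |-> tau (exp (i t)) . f y] with [f] a change of charts of class C^r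
    and [tau] a continuous automorphism of the torus, so that sums and products
    of functions of [t] and of functions of [y] are all that occurs
    ([framed_Ck_action]).  It remains to see that [tau] is smooth, i.e. that a
    continuous character of the line is [t |-> exp (i w t)]
    ([circle_morphism_trig]). *)

(** * Equality in the direct limit of Cech cohomology *)
Section CechEqual.
Context (B : topologicalType) (G : groupType).
Implicit Types (U V W : open_cover B).

Lemma cocycle1 U (c : cocycle G U) i : U i !=set0 -> c i i = 1%g.
Proof.
move=> [x Ux]; have : U i `&` U i `&` U i !=set0 by exists x.
move/(cocycleP c)/(congr1 (fun g => g * (c i i)^-1)%g).
by rewrite -mulgA mulgV mulg1.
Qed.

Lemma cocycleV U (c : cocycle G U) i j :
  U i `&` U j !=set0 -> c j i = (c i j)^-1%g.
Proof.
move=> [x [Ui Uj]]; have : U i `&` U j `&` U i !=set0 by exists x.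
move/(cocycleP c); rewrite cocycle1; last by exists x.
by move/(congr1 (fun g => (c i j)^-1 * g)%g); rewrite mulKg mulg1.
Qed.

Lemma cech_equal_refl (x : cech_pair B G) : cech_equal x x.
Proof.
case: x => U c.
pose s : refinement U U := Refinement (fun i => @subset_refl _ (U i)).
exists U, s, s, (fun=> 1%g) => i j _.
by rewrite mul1g invg1 mulg1.
Qed.

Lemma cech_equal_sym (x y : cech_pair B G) : cech_equal x y -> cech_equal y x.
Proof.
move=> [V [s [t [a ha]]]]; exists V, t, s, (fun i => (a i)^-1%g) => i j ij.
by rewrite ha// invgK -!mulgA mulVg mulg1 mulKg.
Qed.

Lemma cover_meet_full U V :
  \bigcup_(p : cov_idx U * cov_idx V) (U p.1 `&` V p.2) = setT.
Proof.
apply/seteqP; split=> // q _.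
have [i _ Ui] : (\bigcup_i U i) q by rewrite cov_full.
have [j _ Vj] : (\bigcup_j V j) q by rewrite cov_full.
by exists (i, j).
Qed.

Definition cover_meet U V : open_cover B :=
  OpenCover (fun p : cov_idx U * cov_idx V =>
    openI (@cov_open B U p.1) (@cov_open B V p.2))
    (cover_meet_full U V).

(** Both covers carrying the two given equivalences refine the middle cover,
    by refinement maps [t] and [s'] which differ; the cocycle [d] itself
    compares its two restrictions, via [d (s' j) (t i)]. *)
Lemma cech_equal_trans (x y z : cech_pair B G) :
  cech_equal x y -> cech_equal y z -> cech_equal x z.
Proof.
case: x y z => [Ux c] [Uy d] [Uz e] [V [s [t [a ha]]]] [W [s' [t' [b hb]]]].
exists (cover_meet V W).
have sP (p : cov_idx (cover_meet V W)) : cover_meet V W p `<=` Ux (s p.1).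
  by move=> q [Vq _]; apply: (@ref_sub _ _ _ s).
have tP (p : cov_idx (cover_meet V W)) : cover_meet V W p `<=` Uz (t' p.2).
  by move=> q [_ Wq]; apply: (@ref_sub _ _ _ t').
exists (Refinement sP), (Refinement tP).
exists (fun p => (b p.2 * d (s' p.2) (t p.1) * a p.1)%g) => -[i j] [k l] /=.
move=> [q [[/= Vi Wj] [/= Vk Wl]]].
have Vik : V i `&` V k !=set0 by exists q.
have Wjl : W j `&` W l !=set0 by exists q.
move: (ha i k Vik) (hb j l Wjl) => /= dE ->.
have Uti : Uy (t i) q by apply: (@ref_sub _ _ _ t).
have Utk : Uy (t k) q by apply: (@ref_sub _ _ _ t).
have Usj : Uy (s' j) q by apply: (@ref_sub _ _ _ s').
have Usl : Uy (s' l) q by apply: (@ref_sub _ _ _ s').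
have -> : d (s' j) (s' l) =
    (d (s' j) (t i) * d (t i) (t k) * (d (s' l) (t k))^-1)%g.
  rewrite -cocycleV; last by exists q.
  rewrite !cocycleP //; by exists q.
by rewrite dE !invgM !mulgA.
Qed.

(** Classes are encoded as predicates on pairs of a cover and a cocycle, hence
    they agree exactly for related representatives. *)
Lemma cech_class_eqP (U V : open_cover B) (c : cocycle G U) (d : cocycle G V) :
  cech_class c = cech_class d <->
  cech_equal (existT _ U c) (existT _ V d).
Proof.
split=> [/(congr1 (fun K => sval K (existT _ V d))) /= ->|cd].
  exact: cech_equal_refl.
apply: eq_exist; apply/funext => z; apply/propext; split.
  by apply: cech_equal_trans; apply: cech_equal_sym.
exact: cech_equal_trans.
Qed.

End CechEqual.

(** * The orbit map *)
Section OrbitMap.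
Context (R : realType) (n : nat) (r : option nat) (X : topologicalType).
Variable A : ws_atlas R n r X.

Lemma atlas_covers x : exists i, cdom (A i) x.
Proof.
have [i _ Ux] : (\bigcup_i cdom (A i)) x by rewrite ws_cover.
by exists i.
Qed.

Lemma cdom_open i : open (cdom (A i)).
Proof. by have [] := @ws_is_chart _ _ _ _ A i. Qed.

Lemma glue_chart_point i j x (Ui : cdom (A i) x) (Uj : cdom (A j) x) :
  \pi_(orbit_space A) (existT _ i (\pi_(orbits _) (to_cimg Ui))) =
  \pi_(orbit_space A) (existT _ j (\pi_(orbits _) (to_cimg Uj))).
Proof. by apply/orbit_space_eqP; exists x, (to_cimg Ui), (to_cimg Uj). Qed.

(** The chart is picked by choice; by [glue_chart_point] the orbit does not
    depend on it. *)
Definition orbit_map x : orbit_space A :=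
  let: exist i Ui := cid (atlas_covers x) in
  \pi_(orbit_space A) (existT _ i (\pi_(orbits _) (to_cimg Ui))).

Lemma orbit_mapE i x (Ui : cdom (A i) x) :
  orbit_map x = \pi_(orbit_space A) (existT _ i (\pi_(orbits _) (to_cimg Ui))).
Proof. by rewrite /orbit_map; case: cid => j Uj; exact: glue_chart_point. Qed.

Lemma orbit_map_surj q : exists x, orbit_map x = q.
Proof.
have [k _ /orbit_chart_repr[x [z [Ux ez ->]]]] :
    (\bigcup_k orbit_chart_dom (A := A) k) q by rewrite orbit_chart_dom_cover.
exists x; rewrite (orbit_mapE Ux); suff -> : to_cimg Ux = z by [].
by apply/val_inj; exact: esym ez.
Qed.

Lemma orbit_map_dom i x : orbit_chart_dom i (orbit_map x) <-> cdom (A i) x.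
Proof.
have [j Uj] := atlas_covers x; rewrite (orbit_mapE Uj).
exact: orbit_chart_domP.
Qed.

Lemma orbit_map_eqP i x y : cdom (A i) x ->
  orbit_map x = orbit_map y <->
  cdom (A i) y /\ exists u, A i y = std_act u (A i x).
Proof.
move=> Ux; have eqP (Uy : cdom (A i) y) :
    orbit_map x = orbit_map y <-> exists u, A i y = std_act u (A i x).
  rewrite (orbit_mapE Ux) (orbit_mapE Uy).
  have := orbits_eqP (to_cimg Ux) (to_cimg Uy).
  rewrite -[X in X -> _]/(_ <-> exists u, A i y = std_act u (A i x)) => <-.
  split=> [|->//].
  move/orbit_space_eqP => [t [z [w [_ [ez ew]]]]] /= -> ->.
  by congr (\pi _); apply/val_inj; exact: etrans (esym ez) ew.
split=> [e|[Uy Huy]]; last exact: (eqP Uy).2 Huy.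
have Uy : cdom (A i) y by apply/orbit_map_dom; rewrite -e; apply/orbit_map_dom.
by split=> //; exact: (eqP Uy).1 e.
Qed.

Lemma orbit_map_act i u x : cdom (A i) x ->
  exists y, [/\ cdom (A i) y, orbit_map y = orbit_map x &
                A i y = std_act u (A i x)].
Proof.
move=> Ux.
have [y Uy e] : cimg (A i) (std_act u (A i x)).
  by apply: (@ws_invariant _ _ _ _ A i); exists x.
by exists y; split=> //; apply/esym/(orbit_map_eqP y Ux); split=> //; exists u.
Qed.

Lemma chart_continuous_at i x : cdom (A i) x -> {for x, continuous (A i)}.
Proof.
move=> Ux; have [_ _ [_ + _]] := @ws_is_chart _ _ _ _ A i.
rewrite continuous_open_subspace; last exact: cdom_open.
by move=> /(_ x (mem_set Ux)).
Qed.

Lemma chart_nbhs i x (P : set 'rV[R[i]]_n) :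
  cdom (A i) x -> open P -> P (A i x) -> \forall y \near x, P (A i y).
Proof.
by move=> Ux oP Px; apply: (chart_continuous_at Ux); exact: open_nbhs_nbhs.
Qed.

(** Continuity is tested in one chart around each point, the topology of the
    orbit space being the quotient topology of the disjoint union of the chart
    images. *)
Lemma orbit_map_open_preimage (V : set (orbit_space A)) :
  open V -> open (orbit_map @^-1` V).
Proof.
move=> oV; rewrite openE => x Vx.
have [i Ui] := atlas_covers x.
have /sigT_openP/(_ i) := oV; rewrite /open /= /quotient_open => oVi.
move: oVi => [P oP eP].
have PE y (Uy : cdom (A i) y) : P (A i y) <-> V (orbit_map y).
  rewrite (orbit_mapE Uy).
  by rewrite -[P _]/((set_val @^-1` P) (to_cimg Uy)) eP.
have nU : nbhs x (cdom (A i)).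
  exact: open_nbhs_nbhs (conj (@cdom_open i) Ui).
rewrite /interior /=.
apply: filterS (filterI nU (chart_nbhs Ui oP ((PE x Ui).2 Vx))).
by move=> y [Uy Py]; exact: (PE y Uy).1 Py.
Qed.

(** Read in the image of a chart, the preimage of the orbit set is the image of
    [W] itself, because [W] is a union of orbits. *)
Lemma orbit_map_open_image (W : set X) : open W ->
  (forall x y, W x -> orbit_map x = orbit_map y -> W y) ->
  open (orbit_map @` W).
Proof.
move=> oW satW; apply/sigT_openP => j.
have [_ _ [_ _ [g gc gP]]] := @ws_is_chart _ _ _ _ A j.
suff e : \pi_(orbits _) @^-1` (existT _ j @^-1`
    (\pi_(orbit_space A) @^-1` (orbit_map @` W))) = g @^-1` W.
  rewrite /open/= /quotient_open e.
  by move/continuousP: gc; apply.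
apply/seteqP; split=> z /=; have [Ujg eg] := gP z.
  move=> [x Wx ex]; apply: satW Wx _; rewrite ex (orbit_mapE Ujg).
  suff -> : to_cimg Ujg = z by [].
 by apply/val_inj; exact: eg.
move=> Wg; exists (g z) => //; rewrite (orbit_mapE Ujg).
suff -> : to_cimg Ujg = z by [].
 by apply/val_inj; exact: eg.
Qed.

End OrbitMap.

(** * Local equivariance of changes of charts *)
Section LocalEquivariance.
Context (R : realType) (n : nat) (X : topologicalType).
Implicit Types (c d e : chart R n X) (rho : torus_aut R n).

Lemma is_chart_inj c x y : is_chart c ->
  cdom c x -> cdom c y -> c x = c y -> x = y.
Proof. by move=> [_ _ [[_ inj _] _ _]] Ux Uy; apply: inj; rewrite inE. Qed.

Lemma local_rep_chart c d (f : X -> X) x : is_chart d ->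
  cdom d x -> cdom c (f x) -> local_rep c d f (d x) = c (f x).
Proof.
move=> cd Dx Cfx; rewrite /local_rep.
case: xgetP => [_ -> [y [Dy _ e] <-]|/(_ (c (f x)))[]]; last by exists x.
by rewrite (is_chart_inj cd Dy Dx e).
Qed.

Lemma transition_chart c d x : is_chart d -> overlap c d x ->
  transition c d (d x) = c x.
Proof. by move=> cd [Cx Dx]; exact: (@local_rep_chart c d id). Qed.

(** The germ at [x] of the equivariance of a change of charts.  Invariance of
    [W] and equivariance are expressed together, by a lift [z] to [X] of the
    translate of [y]. *)
Definition equivariant_near c d (x : X) : Prop :=
  exists rho (W : set X), [/\ open W, W x, W `<=` overlap c d &
    forall y u, W y -> exists z,
      [/\ W z, d z = std_act u (d y) & c z = std_act (rho u) (c y)]].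

Lemma equivariant_near_sym c d x :
  equivariant_near c d x -> equivariant_near d c x.
Proof.
move=> [rho [W [oW Wx sW eW]]]; exists (aut_inverse rho), W; split=> //.
  by move=> y /sW[].
move=> y u Wy; have [z [Wz dz cz]] := eW y (aut_inverse rho u) Wy.
by exists z; split=> //; rewrite cz -{2}(autVK rho u).
Qed.

(** The middle chart is injective, so the lifts provided by the two hypotheses
    coincide and lie in both neighbourhoods. *)
Lemma equivariant_near_trans c d e x : is_chart d ->
  equivariant_near c d x -> equivariant_near d e x -> equivariant_near c e x.
Proof.
move=> dchart [rho [W [oW Wx sW eW]]] [rho' [W' [oW' Wx' sW' eW']]].
exists (aut_comp rho rho'), (W `&` W'); split=> //; first exact: openI.
  by move=> y [/sW[cy _] /sW'[_ ey]].
move=> y u [Wy Wy']; have [z [Wz' ez dz]] := eW' y u Wy'.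
have [t [Wt dt ct]] := eW y (rho' u) Wy.
have tz : t = z.
  by apply: (is_chart_inj dchart); [case/sW: Wt|case/sW': Wz'|rewrite dt dz].
by subst t; exists z; split.
Qed.

Lemma equivariant_diffeo_near r rho c d x : is_chart c -> is_chart d ->
  equivariant_diffeo r rho c d -> overlap c d x -> equivariant_near c d x.
Proof.
move=> cc cd [_ invd eqv _] Ox; exists rho, (overlap c d); split=> //.
  by apply: openI; [case: cc|case: cd].
move=> y u Oy; have [|z Oz dz] := invd u (d y); first by exists y.
exists z; split=> //.
rewrite -(transition_chart cd Oz) dz eqv; last by exists y.
by rewrite (transition_chart cd Oy).
Qed.

(** Unlike [atlas_equiv], nearness of charts is transitive without any
    connectedness of the overlaps, and therefore passes to the equivalence
    relation generated by [atlas_equiv]. *)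
Lemma atlas_class_near r (A B : ws_atlas R n r X) : atlas_class A B ->
  forall i j x, overlap (A i) (B j) x -> equivariant_near (A i) (B j) x.
Proof.
elim=> {A B} [A B AB|A|A B _ IH|A B C _ AB _ BC] i j x Ox.
- have [|rho] := AB i j; first by exists x.
  by move/equivariant_diffeo_near; apply=> //; exact: ws_is_chart.
- have [|rho] := @ws_compatible _ _ _ _ A i j; first by exists x.
  by move/equivariant_diffeo_near; apply=> //; exact: ws_is_chart.
- by apply/equivariant_near_sym/IH; case: Ox.
- have [k Uk] := atlas_covers B x; case: Ox => Ui Uj.
  apply: (@equivariant_near_trans _ (B k)); first exact: ws_is_chart.
    exact: AB.
  exact: BC.
Qed.

End LocalEquivariance.

(** * An inducing action trivializes the cocycle *)
Section Trivialization.
Context (R : realType) (n : nat) (r : option nat) (X : topologicalType).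
Variables (A : ws_atlas R n r X) (rho : ws_idx A -> ws_idx A -> torus_aut R n).
Hypothesis rhoA : associated rho.
Variables (S : ws_atlas R n r X) (sigma : ws_idx S -> torus_aut R n).
Variable a : torus_action R n X.
Hypothesis AS : atlas_class A S.
Hypothesis Sstd : forall i u x, cdom (S i) x ->
  cdom (S i) (a u x) /\ S i (a u x) = std_act (sigma i u) (S i x).

(** The automorphism is part of the patch, so that the patches themselves index
    a cover of the orbit space together with a 0-cochain on it. *)
Record equivariant_patch := EquivariantPatch {
  patch_chart : ws_idx A;
  patch_aut : torus_aut R n;
  patch_set : set X;
  patch_open : open patch_set;
  patch_sub : patch_set `<=` cdom (A patch_chart);
  patchP : forall u x, patch_set x -> patch_set (a u x) /\
    A patch_chart (a u x) = std_act (patch_aut u) (A patch_chart x) }.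

(** Near [x] a chart of [A] is equivariant with respect to a chart of [S] (the
    automorphism [tau]), which is equivariant with respect to the action (the
    automorphism [sigma j]). *)
Lemma patch_at x : exists p, patch_set p x.
Proof.
have [i Ui] := atlas_covers A x; have [j Uj] := atlas_covers S x.
have [tau [W [oW Wx sW eW]]] := atlas_class_near AS (conj Ui Uj).
have sA : W `<=` cdom (A i) by move=> y /sW[].
have PW u y : W y -> W (a u y) /\
    A i (a u y) = std_act (aut_comp tau (sigma j) u) (A i y).
  move=> Wy; have [_ Sy] := sW _ Wy; have [Sau eau] := Sstd u Sy.
  have [z [Wz ez cz]] := eW y (sigma j u) Wy.
  suff -> : a u y = z by split.
  apply: (is_chart_inj (ws_is_chart (w := S) j)) => //.
    by case: (sW _ Wz).
  by rewrite eau ez.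
by exists (EquivariantPatch oW sA PW).
Qed.

Lemma patch_saturated p x y : patch_set p x ->
  orbit_map A x = orbit_map A y -> patch_set p y.
Proof.
move=> px /(orbit_map_eqP _ (patch_sub px))[Uy [u ey]].
have [pz ez] := patchP (aut_inv (patch_aut p) u) px.
rewrite autVK -ey in ez.
by rewrite -(is_chart_inj (ws_is_chart (w := A) _) (patch_sub pz) Uy ez).
Qed.

Lemma patch_cover_open p : open (orbit_map A @` patch_set p).
Proof.
by apply: orbit_map_open_image (patch_open p) _; exact: patch_saturated.
Qed.

Lemma patch_cover_full : \bigcup_p (orbit_map A @` patch_set p) = setT.
Proof.
apply/seteqP; split=> // q _; have [x <-] := orbit_map_surj q.
by have [p px] := patch_at x; exists p => //; exists x.
Qed.

Definition patch_cover : open_cover (orbit_space A) :=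
  OpenCover patch_cover_open patch_cover_full.

Lemma patch_cover_sub (p : cov_idx patch_cover) :
  patch_cover p `<=` orbit_cover A (patch_chart p).
Proof. by move=> _ [x px <-]; apply/orbit_map_dom; exact: patch_sub. Qed.

(** Both automorphisms describe the action on the intersection of the patches,
    which contains a point with nonzero coordinates.  The stabilizer of that
    point is trivial, so the automorphisms can be compared there. *)
Lemma patch_transition p q x : patch_set p x -> patch_set q x ->
  rho (patch_chart p) (patch_chart q) = (patch_aut p * (patch_aut q)^-1)%g.
Proof.
set i := patch_chart p; set j := patch_chart q => px qx.
pose O := patch_set p `&` patch_set q.
have oO : open O by apply: openI; exact: patch_open.
have sOi : O `<=` cdom (A i) by move=> y [/patch_sub].
have [|_ [y [py qy] <-] yfree] := open_free (chart_image_open oO sOi).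
  by exists (A i x); exists x.
have Oy : overlap (A i) (A j) y by split; exact: patch_sub.
have [_ _ eqv _] := rhoA (ex_intro _ y Oy).
have transE u : rho i j (patch_aut q u) = patch_aut p u.
  have [pu epu] := patchP u py; have [qu equ] := patchP u qy.
  have Oyu : overlap (A i) (A j) (a u y) by split; exact: patch_sub.
  have /rowP e : std_act (patch_aut p u) (A i y) =
                 std_act (rho i j (patch_aut q u)) (A i y).
    rewrite -epu -(transitionE Oyu) equ eqv; last by exists y.
    by rewrite (transitionE Oy).
  apply: torus_ext => k; apply/esym.
  by move: (e k); rewrite !mxE => /mulIf; apply.
by apply: torus_aut_ext => u /=; rewrite -transE autVK.
Qed.

Lemma induced_cocycle_trivial :
  cech_equal (existT _ _ (atlas_cocycle rhoA))
             (existT _ _ (trivial_cocycle (torus_aut R n) (orbit_cover A))).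
Proof.
pose s := Refinement patch_cover_sub.
exists patch_cover, s, s, (fun p => (patch_aut p)^-1%g) => p q /=.
move=> [_ [[x px <-] [y qy e]]].
rewrite (@patch_transition _ _ x px (patch_saturated qy e)).
by rewrite invgK mulKg mulVg.
Qed.

End Trivialization.

(** * Calculus of maps of class C^k *)
Section CkCalculus.
Context (R : realType).
Implicit Types (V W Z : normedModType R).

Lemma Ck_sub V W k (U U' : set V) (f : V -> W) :
  U' `<=` U -> Ck k U f -> Ck k U' f.
Proof.
elim: k f => [|k IH] f sU /=; first by move=> cf x /sU; exact: cf.
by move=> [df Df]; split=> [x /sU|v]; [exact: df|exact: IH].
Qed.

Lemma Ck_bigcup V W k (I : Type) (P : set I) (U : I -> set V) (f : V -> W) :
  (forall i, P i -> Ck k (U i) f) -> Ck k (\bigcup_(i in P) U i) f.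
Proof.
elim: k f => [|k IH] f /= cU; first by move=> x [i Pi Ui]; exact: cU Ui.
split=> [x [i Pi Ui]|v]; first by have [+ _] := cU i Pi; exact.
by apply: IH => i /cU[].
Qed.

(** The differential is defined by a choice among linear maps, so locally equal
    functions are first shown to have the same first order expansion. *)
Lemma near_eq_differentiable V W (f g : V -> W) x :
  (\near x, f x = g x) -> differentiable f x -> differentiable g x.
Proof.
move=> fg df; suff [cd ed] : continuous ('d f x) /\
    g \o shift x = cst (g x) + 'd f x +o_ 0 id.
  by apply/diff_locallyP; rewrite (diff_unique cd ed).
have /diff_locallyP[cd /eqaddoP ed] := df; split=> //.
apply/eqaddoP => e e0; have {}ed := ed e e0.
have fgx := nbhs_singleton fg.
near=> h.
rewrite (_ : (g \o shift x - _) h = (f \o shift x - (cst (f x) + 'd f x)) h).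
  by near: h.
rewrite /= !fctE /= fgx; congr (_ - _).
apply/esym; near: h.
by move: fg; rewrite [X in X -> _](near_shift 0 x) subr0.
Unshelve. all: by end_near. Qed.

(** Openness makes the derivatives agree as well, which the induction needs. *)
Lemma Ck_ext V W k (U : set V) (f g : V -> W) : open U ->
  (forall x, U x -> f x = g x) -> Ck k U f -> Ck k U g.
Proof.
move=> oU; have nearU (h h' : V -> W) x :
    (forall x, U x -> h x = h' x) -> U x -> \near x, h x = h' x.
  by move=> hh' Ux; apply: filterS (open_nbhs_nbhs (conj oU Ux)) => y /hh'.
elim: k f g => [|k IH] f g fg /=.
  move=> cf x Ux; rewrite /prop_for /continuous_at -(fg x Ux).
  by apply: cvg_trans (cf x Ux); apply: near_eq_cvg; exact: nearU.
move=> [df Df]; split=> [x Ux|v].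
  by apply: near_eq_differentiable (df x Ux); exact: nearU.
apply: IH (Df v) => x Ux; apply: near_eq_derive; exact: nearU.
Qed.

Lemma Ck_continuous V W k (U : set V) (f : V -> W) x :
  Ck k U f -> U x -> {for x, continuous f}.
Proof.
case: k => [|k] /= cf Ux; first exact: cf.
by apply: differentiable_continuous; case: cf => + _; apply.
Qed.

Lemma CkW V W k (U : set V) (f : V -> W) : Ck k.+1 U f -> Ck k U f.
Proof.
elim: k f => [|k IH] f Cf; first by move=> x; exact: Ck_continuous Cf.
by case: Cf => df Df; split=> // v; exact: IH.
Qed.

Lemma Ck_cst V W k (U : set V) (c : W) : Ck k U (cst c).
Proof.
elim: k c => [|k IH] c /=; first by move=> x _; exact: cst_continuous.
split=> [x _|v]; first exact: differentiable_cst.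
rewrite (_ : (fun x => _) = cst 0); first exact: IH.
by apply/funext => x; rewrite derive_cst.
Qed.

(** Along a linear map the chain rule has constant coefficients,
    [D_v (f o l) = (D_(l v) f) o l], so the induction stays within maps of the
    form [f o l]. *)
Lemma Ck_linear_pre V W Z k (U : set W) (l : {linear V -> W}) (f : W -> Z) :
  continuous l -> open U -> Ck k U f -> Ck k (l @^-1` U) (f \o l).
Proof.
move=> cl oU; have oV : open (l @^-1` U) by move/continuousP: cl; apply.
elim: k f => [|k IH] f /=.
  by move=> cf x Ux; apply: continuous_comp; [exact: cl|exact: cf].
move=> [df Df]; have dl x : differentiable l x by exact: linear_differentiable.
have dfl x : U (l x) -> differentiable (f \o l) x.
  by move=> Ux; apply: differentiable_comp => //; exact: df.
split=> [x Ux|v]; first exact: dfl.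
apply: Ck_ext (IH _ (Df (l v))) => // x Ux /=.
rewrite (deriveE _ (dfl x Ux)) (deriveE _ (df _ Ux)).
rewrite (diff_comp (dl x) (df _ Ux))/=.
by rewrite (diff_lin _ cl).
Qed.

Lemma Ck_linear_post V W Z k (U : set V) (l : {linear W -> Z}) (f : V -> W) :
  continuous l -> open U -> Ck k U f -> Ck k U (l \o f).
Proof.
move=> cl oU; elim: k f => [|k IH] f /=.
  by move=> cf x Ux; apply: continuous_comp; [exact: cf|exact: cl].
move=> [df Df]; have dl x : differentiable l x by exact: linear_differentiable.
have dlf x : U x -> differentiable (l \o f) x.
  by move=> Ux; apply: differentiable_comp => //; exact: df.
split=> [x Ux|v]; first exact: dlf.
apply: Ck_ext (IH _ (Df v)) => // x Ux /=.
rewrite (deriveE _ (dlf x Ux)) (deriveE _ (df _ Ux)).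
rewrite (diff_comp (df x Ux) (dl _))/=.
by rewrite (diff_lin _ cl).
Qed.

Lemma Ck_add V W k (U : set V) (f g : V -> W) : open U ->
  Ck k U f -> Ck k U g -> Ck k U (fun x => f x + g x).
Proof.
move=> oU; elim: k f g => [|k IH] f g /=.
  by move=> cf cg x Ux; apply: cvgD; [exact: cf|exact: cg].
move=> [df Df] [dg Dg]; split=> [x Ux|v].
  by apply: differentiableD; [exact: df|exact: dg].
apply: Ck_ext (IH _ _ (Df v) (Dg v)) => // x Ux.
by rewrite deriveD//; apply: diff_derivable; [exact: df|exact: dg].
Qed.

Lemma Ck_sum V W k (U : set V) (I : Type) (s : seq I) (f : I -> V -> W) :
  open U -> (forall i, Ck k U (f i)) -> Ck k U (fun x => \sum_(i <- s) f i x).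
Proof.
move=> oU Cf; elim: s => [|i s IH].
  by apply: Ck_ext (Ck_cst k U 0) => // x _; rewrite big_nil.
by apply: Ck_ext (Ck_add oU (Cf i) IH) => // x _; rewrite big_cons.
Qed.

Lemma Ck_mul V k (U : set V) (f g : V -> R) : open U ->
  Ck k U f -> Ck k U g -> Ck k U (fun x => f x * g x).
Proof.
move=> oU; elim: k f g => [|k IH] f g.
  by move=> cf cg x Ux; apply: cvgM; [exact: cf|exact: cg].
move=> Cf Cg; have [df Df] := Cf; have [dg Dg] := Cg; split=> [x Ux|v].
  by apply: differentiableM; [exact: df|exact: dg].
have Cfg := Ck_add oU (IH _ _ (CkW Cf) (Dg v)) (IH _ _ (CkW Cg) (Df v)).
apply: Ck_ext Cfg => // x Ux.
by rewrite deriveM//; apply: diff_derivable; [exact: df|exact: dg].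
Qed.

Lemma Ck_scale_vector V W k (U : set V) (f : V -> R) (w : W) : open U ->
  Ck k U f -> Ck k U (fun x => f x *: w).
Proof.
move=> oU; elim: k f => [|k IH] f /=.
  by move=> cf x Ux; apply: cvgZr_tmp; exact: cf.
move=> [df Df]; split=> [x Ux|v]; first by apply: differentiableZl; exact: df.
apply: Ck_ext (IH _ (Df v)) => // x Ux.
have dfx := df x Ux.
rewrite (deriveE _ dfx) (deriveE _ (differentiableZl w dfx)).
by rewrite diffZl.
Qed.

Lemma Ck_row V k (U : set V) m (f : V -> 'rV[R]_m) : open U ->
  (forall j, Ck k U (fun x => f x ord0 j)) -> Ck k U f.
Proof.
move=> oU Cf; have Cs j := Ck_scale_vector (delta_mx 0 j : 'rV[R]_m) oU (Cf j).
apply: Ck_ext (Ck_sum (index_enum _) oU Cs) => // x _.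
by rewrite -row_sum_delta.
Qed.

Lemma Ck_coord V k (U : set V) m (f : V -> 'rV[R]_m) j : open U ->
  Ck k U f -> Ck k U (fun x => f x ord0 j).
Proof.
move=> oU Cf; have clin : linear (fun M : 'rV[R]_m => M ord0 j : R).
  by move=> a u v; rewrite !mxE.
pose cM := GRing.isLinear.Build _ _ _ _ _ clin.
pose cL : {linear _ -> _} := HB.pack (fun M : 'rV[R]_m => M ord0 j : R) cM.
exact: (Ck_linear_post (l := cL) (@coord_continuous _ _ _ _ _) oU Cf).
Qed.

End CkCalculus.

(** * One-parameter subgroups of the circle *)
Section CircleCharacters.
Context (R : realType).
Implicit Types (f C S : R -> R).

Lemma is_derive_comb f g (a b x df dg : R) :
  is_derive x 1 f df -> is_derive x 1 g dg ->
  is_derive x 1 (fun y => a * f y + b * g y) (a * df + b * dg).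
Proof.
move=> hf hg.
exact: (is_deriveD (@is_deriveZ _ _ _ f a x 1 df hf)
                   (@is_deriveZ _ _ _ g b x 1 dg hg)).
Qed.

Lemma is_derive_mul f g (x df dg : R) :
  is_derive x 1 f df -> is_derive x 1 g dg ->
  is_derive x 1 (fun y => f y * g y) (df * g x + f x * dg).
Proof.
move=> hf hg; apply: (is_derive_eq (is_deriveM hf hg)).
by rewrite /GRing.scale /= addrC (mulrC df).
Qed.

Lemma is_derive_addl f (t x df : R) :
  is_derive (t + x) 1 f df -> is_derive x 1 (fun y => f (t + y)) df.
Proof.
move=> hf; have := is_derive_shift x 1 t.
rewrite (_ : shift t = +%R t); last by apply/funext => y; rewrite /= addrC.
by move=> /(is_derive1_comp hf); rewrite mulr1.
Qed.

Lemma is_derive0_itv f (h : R) : 0 <= h ->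
  (forall x : R, 0 <= x <= h -> is_derive x 1 f 0) -> f h = f 0.
Proof.
move=> h0 df; have [||x _] := @MVT_segment _ f (cst 0) 0 h h0.
- by move=> x; rewrite in_itv /= => xh; apply: df; lra.
- by apply: derivable_within_continuous => x /= /df.
by rewrite mul0r => /subr0_eq.
Qed.

Lemma local_primitive f : continuous f ->
  exists F : R -> R, forall x : R, x \in `]-2, 2[%R -> is_derive x 1 F (f x).
Proof.
move=> cf.
exists (fun x => (\int[lebesgue_measure]_(t in [set` `[-2, x]]) f t))%R.
move=> x; rewrite in_itv /= => /andP[lx xu].
have fi : lebesgue_measure.-integrable `[-2, 2] (EFin \o f).
  apply: continuous_compact_integrable; first exact: segment_compact.
  exact: continuous_subspaceT.
have [dF eF] := continuous_FTC1_closed xu fi lx (cf x).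
by constructor; [exact: dF|rewrite -derive1E; exact: eF].
Qed.

(** The real and imaginary parts of a homomorphism from the line to the unit
    circle. *)
Definition circle_morphism C S :=
  [/\ forall s t, C (s + t) = C s * C t - S s * S t,
      forall s t, S (s + t) = S s * C t + C s * S t &
      forall t, C t ^+ 2 + S t ^+ 2 = 1].

Lemma circle_morphism0 C S : circle_morphism C S -> C 0 = 1 /\ S 0 = 0.
Proof.
move=> [Cadd Sadd CS]; have := CS 0.
have := Cadd 0 0; have := Sadd 0 0; rewrite !addr0.
set c := C 0; set s := S 0 => es ec cs.
have s0 : s = 0.
  have : s * (1 - 2 * c) = 0 by rewrite mulrBr mulr1 {1}es; ring.
  move/eqP; rewrite mulf_eq0 => /orP[/eqP//|/eqP c2].
  have c12 : c = 1 / 2 by lra.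
  by exfalso; have := sqr_ge0 s; rewrite expr2; move: ec; rewrite c12; lra.
split=> //; move: cs ec.
by rewrite s0 !(mulr0, subr0, expr0n, addr0) /= expr2 => <-.
Qed.

(** Integrating the addition formulas in one variable over the interval from [0]
    to [h] expresses increments of the primitives of [C] and [S], which are
    differentiable, linearly through [C] and [S]; for small [h] the system can
    be solved. *)
Lemma circle_morphism_derivable0 C S : continuous C -> continuous S ->
  circle_morphism C S -> derivable C 0 1 /\ derivable S 0 1.
Proof.
move=> cC cS CSm; have [C0 S0] := circle_morphism0 CSm.
have [Cadd Sadd CS] := CSm.
have [F dF] := local_primitive cC; have [G dG] := local_primitive cS.
have [h h01 Ch] : exists2 h, 0 < h < 1 & forall x, 0 <= x <= h -> 0 < C x.
  have /cvgrPdist_lt/(_ _ ltr01) := cC 0; rewrite C0 => /nbhs_ballP[e /= e0 he].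
  exists (Num.min (e / 2) (1/2)).
    by rewrite lt_min gt_min; apply/andP; split; lra.
  move=> x /andP[x0 xh]; have /he : ball 0 e x.
    rewrite /ball /= sub0r normrN ger0_norm//.
    by move: xh; rewrite le_min => /andP[]; lra.
  by rewrite ltr_norml => /andP[]; lra.
(* [t] and [h] are less than 1, and [F] and [G] are primitives on ]-2, 2[. *)
have F'h (t x : R) : -1 < t < 1 -> 0 <= x <= h ->
    [/\ is_derive x 1 F (C x), is_derive x 1 G (S x),
      is_derive x 1 (fun y => F (t + y)) (C (t + x)) &
      is_derive x 1 (fun y => G (t + y)) (S (t + x))].
  move=> t1 xh; have x2 : x \in `]-2, 2[ by rewrite in_itv /=; lra.
  have tx2 : t + x \in `]-2, 2[ by rewrite in_itv /=; lra.
  split; [exact: dF|exact: dG| |].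
    exact: is_derive_addl (dF _ tx2).
  exact: is_derive_addl (dG _ tx2).
have addF (t : R) : -1 < t < 1 ->
    F (t + h) - F t = C t * (F h - F 0) - S t * (G h - G 0) /\
    G (t + h) - G t = S t * (F h - F 0) + C t * (G h - G 0).
  move=> t1; split.
    pose u x := 1 * F (t + x) + 1 * (- C t * F x + S t * G x).
    have : u h = u 0.
      apply: is_derive0_itv => [|x xh]; first lra.
      have [dFx dGx dFt _] := F'h t x t1 xh.
      have := is_derive_comb 1 1 dFt (is_derive_comb (- C t) (S t) dFx dGx).
      by move/is_derive_eq; apply; rewrite Cadd; ring.
    by rewrite /u addr0; lra.
  pose u x := 1 * G (t + x) + 1 * (- S t * F x + - C t * G x).
  have : u h = u 0.
    apply: is_derive0_itv => [|x xh]; first lra.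
    have [dFx dGx _ dGt] := F'h t x t1 xh.
    have := is_derive_comb 1 1 dGt (is_derive_comb (- S t) (- C t) dFx dGx).
    by move/is_derive_eq; apply; rewrite Sadd; ring.
  by rewrite /u addr0; lra.
pose p := F h - F 0; pose q := G h - G 0.
(* [p] is positive, as [F' = C] is positive on [0, h]. *)
have p0 : p != 0.
  have h0 : 0 < h by case/andP: h01.
  have dFh (x : R) : 0 <= x <= h -> is_derive x 1 F (C x).
    by move=> xh; have [] := F'h 0 x _ xh; first lra.
  have dFi (x : R) : x \in `]0, h[ -> is_derive x 1 F (C x).
    by rewrite in_itv /= => xh; apply: dFh; lra.
  have cF : {within `[0, h], continuous F}.
    by apply: derivable_within_continuous => x; rewrite in_itv /= => /dFh[].
  have [x] := MVT h0 dFi cF.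
  rewrite in_itv /= => xh pE; rewrite /p pE mulf_neq0 ?gt_eqF//; last lra.
  by apply: Ch; lra.
have pq0 : p ^+ 2 + q ^+ 2 != 0.
  by rewrite gt_eqF// ltr_pwDl ?sqr_ge0// exprn_even_gt0.
pose N := (p ^+ 2 + q ^+ 2)^-1.
have near1 : \forall t \near (0 : R), -1 < t < 1.
  apply: filterS (nbhsx_ballx (0 : R) 1 ltr01) => t.
  by rewrite /ball /= sub0r normrN ltr_norml.
have dF0 : is_derive (0 : R) 1 F (C 0) by apply: dF; rewrite in_itv /=; lra.
have dG0 : is_derive (0 : R) 1 G (S 0) by apply: dG; rewrite in_itv /=; lra.
have dFh : is_derive (0 : R) 1 (fun t => F (h + t)) (C (h + 0)).
  by apply: is_derive_addl; apply: dF; rewrite in_itv /=; lra.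
have dGh : is_derive (0 : R) 1 (fun t => G (h + t)) (S (h + 0)).
  by apply: is_derive_addl; apply: dG; rewrite in_itv /=; lra.
(* The increments in [addF] are [p C - q S] and [p S + q C]; [p] and [q] are
   used below to solve for [C] and [S]. *)
have dA := is_derive_comb 1 (-1) dFh dF0.
have dB := is_derive_comb 1 (-1) dGh dG0.
split.
  have dC := is_derive_comb (N * p) (N * q) dA dB.
  apply: near_eq_derivable (@ex_derive _ _ _ _ _ _ _ dC).
  apply: filterS near1 => t /addF[]; rewrite -/p -/q => eA eB.
  rewrite !mul1r !mulN1r (addrC h) eA eB.
  by rewrite /N; field.
have dS := is_derive_comb (- N * q) (N * p) dA dB.
apply: near_eq_derivable (@ex_derive _ _ _ _ _ _ _ dS).
apply: filterS near1 => t /addF[]; rewrite -/p -/q => eA eB.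
rewrite !mul1r !mulN1r (addrC h) eA eB.
by rewrite /N; field.
Qed.

(** Differentiability at [0] propagates by the addition formulas and turns them
    into [C' = - w S] and [S' = w C].  The products of [C + i S] with
    [cos (w t) - i sin (w t)] then have derivative zero. *)
Lemma circle_morphism_trig C S : continuous C -> continuous S ->
  circle_morphism C S ->
  exists w, forall t, C t = cos (w * t) /\ S t = sin (w * t).
Proof.
move=> cC cS CSm; have [C0 S0] := circle_morphism0 CSm.
have [dC dS] := circle_morphism_derivable0 cC cS CSm.
have [Cadd Sadd CS] := CSm.
pose w := 'D_1 S 0; exists w.
have d0C := derivableP dC; have d0S := derivableP dS.
have dC0 : 'D_1 C 0 = 0.
  have := is_derive_comb 1 1 (is_derive_mul d0C d0C) (is_derive_mul d0S d0S).
  rewrite (_ : (fun y => _) = cst 1); last first.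
    by apply/funext => t; rewrite !mul1r -!expr2 CS.
  by move/(@derive_val _ _ _ _ _ _ _); rewrite derive_cst C0 S0; lra.
have dCmt (t : R) : is_derive t 1 (fun y => C (- t + y)) 0.
  apply: is_derive_addl; rewrite addNr -[X in is_derive _ _ _ X]dC0.
  exact: d0C.
have dSmt (t : R) : is_derive t 1 (fun y => S (- t + y)) w.
  by apply: is_derive_addl; rewrite addNr; exact: d0S.
have dCt (t : R) : is_derive t 1 C (- (w * S t)).
  have := is_derive_comb (C t) (- S t) (dCmt t) (dSmt t).
  rewrite (_ : (fun y => _) = C); last first.
    by apply/funext => y; rewrite mulNr -Cadd addNKr.
  by move/is_derive_eq; apply; ring.
have dSt (t : R) : is_derive t 1 S (w * C t).
  have := is_derive_comb (S t) (C t) (dCmt t) (dSmt t).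
  rewrite (_ : (fun y => _) = S); last first.
    by apply/funext => y; rewrite -Sadd addNKr.
  by move/is_derive_eq; apply; ring.
have dw (t : R) : is_derive t 1 (fun t => w * t) w.
  have := @is_deriveZ _ _ _ id w t 1 1 (is_derive_id t 1).
  by rewrite /GRing.scale /= mulr1.
have dcos (t : R) : is_derive t 1 (fun t => cos (w * t)) (- (sin (w * t)) * w).
  exact: (is_derive1_comp (is_derive_cos _) (dw t)).
have dsin (t : R) : is_derive t 1 (fun t => sin (w * t)) (cos (w * t) * w).
  exact: (is_derive1_comp (is_derive_sin _) (dw t)).
have E1 t : C t * cos (w * t) + S t * sin (w * t) = 1.
  pose u y := 1 * (C y * cos (w * y)) + 1 * (S y * sin (w * y)).
  have : u t = u 0.
    apply: is_derive_0_is_cst => x.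
    have := is_derive_comb 1 1 (is_derive_mul (dCt x) (dcos x))
                               (is_derive_mul (dSt x) (dsin x)).
    by move/is_derive_eq; apply; ring.
  by rewrite /u C0 S0 mulr0 cos0 sin0; lra.
have E2 t : S t * cos (w * t) - C t * sin (w * t) = 0.
  pose u y := 1 * (S y * cos (w * y)) + -1 * (C y * sin (w * y)).
  have : u t = u 0.
    apply: is_derive_0_is_cst => x.
    have := is_derive_comb 1 (-1) (is_derive_mul (dSt x) (dcos x))
                                  (is_derive_mul (dCt x) (dsin x)).
    by move/is_derive_eq; apply; ring.
  by rewrite /u C0 S0 mulr0 cos0 sin0; lra.
move=> t; have := E1 t; have := E2 t; have := cos2Dsin2 (w * t).
set c := cos _; set s := sin _ => e3 e2 e1; split.
  rewrite -[LHS]mulr1 -e3.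
  transitivity ((C t * c + S t * s) * c - (S t * c - C t * s) * s).
    by ring.
  by rewrite e1 e2; ring.
rewrite -[LHS]mulr1 -e3.
transitivity ((C t * c + S t * s) * s + (S t * c - C t * s) * c).
  by ring.
by rewrite e1 e2; ring.
Qed.

End CircleCharacters.

(** * Topology of complex row vectors *)
Section ComplexTopology.
Context (R : realType).

Lemma continuous_mx (T : topologicalType) (K : topologicalType) m n
    (f : T -> 'M[K]_(m, n)) x :
  (forall i j, {for x, continuous (fun y => f y i j)}) -> {for x, continuous f}.
Proof.
move=> cf B [P nP sPB]; rewrite /= nbhs_filterE.
have : \forall y \near x, forall i j, P i j (f y i j).
  apply: filter_forall => i; apply: filter_forall => j.
  exact: (cf i j _ (nP i j)).
by apply: filterS => y /sPB.
Qed.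

Lemma Re_norm_le (z : R[i]) : (`|complex.Re z|)%:C%C <= `|z|.
Proof.
rewrite normc_def lecR -sqrtr_sqr ler_wsqrtr// lerDl; exact: sqr_ge0.
Qed.

Lemma Im_norm_le (z : R[i]) : (`|complex.Im z|)%:C%C <= `|z|.
Proof.
rewrite normc_def lecR -sqrtr_sqr ler_wsqrtr// lerDr; exact: sqr_ge0.
Qed.

Lemma Complex_norm_le (a b : R) : `|Complex a b| <= (`|a| + `|b|)%:C%C.
Proof.
rewrite normc_def lecR /= -[leRHS]ger0_norm ?addr_ge0// -sqrtr_sqr ler_wsqrtr//.
by rewrite sqrrD !real_normK ?num_real// addrAC lerDl mulrn_wge0 ?mulr_ge0.
Qed.

Lemma Re_continuous : continuous (@complex.Re R : R[i] -> R).
Proof.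
move=> z; have Hz : Filter (nbhs (z : R[i])) := nbhs_filter (z : R[i]).
apply/cvgrPdist_lt => e e0.
have e0' : 0 < e%:C%C by rewrite ltcR.
apply: (@filterS _ _ Hz _ _ _ (nbhsx_ballx (z : R[i]) _ e0')) => w.
rewrite -ball_normE /= => zw.
by rewrite -ltcR -raddfB; apply: le_lt_trans (Re_norm_le _) zw.
Qed.

Lemma Im_continuous : continuous (@complex.Im R : R[i] -> R).
Proof.
move=> z; have Hz : Filter (nbhs (z : R[i])) := nbhs_filter (z : R[i]).
apply/cvgrPdist_lt => e e0.
have e0' : 0 < e%:C%C by rewrite ltcR.
apply: (@filterS _ _ Hz _ _ _ (nbhsx_ballx (z : R[i]) _ e0')) => w.
rewrite -ball_normE /= => zw.
by rewrite -ltcR -raddfB; apply: le_lt_trans (Im_norm_le _) zw.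
Qed.

Lemma Complex_continuous (T : topologicalType) (f g : T -> R) x :
  {for x, continuous f} -> {for x, continuous g} ->
  {for x, continuous (fun y => Complex (f y) (g y) : R[i])}.
Proof.
move=> cf cg; apply/cvgrPdist_lt => e e0.
have e20 : 0 < complex.Re e / 2.
  by move: e0; rewrite ltcE => /andP[_ /= e0]; rewrite divr_gt0.
have eE : e = (complex.Re e)%:C%C.
  by move: e0; rewrite ltcE => /andP[/eqP + _]; case: (e) => a b /= ->.
have /cvgrPdist_lt/(_ _ e20) cf' := cf; have /cvgrPdist_lt/(_ _ e20) cg' := cg.
apply: filterS (filterI cf' cg') => y [fy gy].
rewrite eE; apply: le_lt_trans (Complex_norm_le (f x - f y) (g x - g y)) _.
by rewrite ltcR (splitr (complex.Re e)) ltrD.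
Qed.

Lemma realifyK n : cancel (@realify R n) (@complexify R n).
Proof.
move=> z; apply/rowP => k; rewrite mxE [lsubmx _ _ _]mxE [rsubmx _ _ _]mxE.
rewrite /realify row_mxEl row_mxEr !mxE.
by case: (z ord0 k).
Qed.

Lemma complexifyK n : cancel (@complexify R n) (@realify R n).
Proof.
move=> x; apply/rowP => k; rewrite /realify.
case: (splitP k) => j kj.
  by rewrite (_ : k = lshift n j) ?row_mxEl ?mxE//; exact/val_inj.
by rewrite (_ : k = rshift n j) ?row_mxEr ?mxE//; exact/val_inj.
Qed.

Lemma complexify_continuous n : continuous (@complexify R n).
Proof.
move=> x; apply: continuous_mx => i j.
rewrite (_ : (fun y => _) = fun y : 'rV[R]_(n + n) =>
    Complex (y ord0 (lshift n j)) (y ord0 (rshift n j))); last first.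
  by apply/funext => y; rewrite !mxE.
by apply: Complex_continuous; exact: coord_continuous.
Qed.

(** Rewriting images under [realify] as preimages under [complexify] turns
    openness of such images into continuity. *)
Lemma realify_image n (U : set 'rV[R[i]]_n) :
  (@realify R n) @` U = (@complexify R n) @^-1` U.
Proof.
apply/seteqP; split=> [_ [z Uz <-] /=|x /= Ux]; first by rewrite realifyK.
by exists (complexify x) => //; rewrite complexifyK.
Qed.

Lemma realify_image_open n (U : set 'rV[R[i]]_n) : open U ->
  open ((@realify R n) @` U).
Proof.
rewrite realify_image => oU; have /continuousP := @complexify_continuous n.
exact.
Qed.

End ComplexTopology.

(** * Automorphisms of the torus are smooth *)
Section TorusAutomorphisms.
Context (R : realType).

Definition cis (x : R) : R[i] := Complex (cos x) (sin x).

Lemma cisD x y : cis (x + y) = cis x * cis y.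
Proof. by rewrite /cis cosD sinD; congr Complex; rewrite addrC. Qed.

Lemma cis0 : cis 0 = 1.
Proof. by rewrite /cis cos0 sin0. Qed.

Context (n : nat).

Lemma torus_val_continuous : continuous (fun u : torus R n => \val u).
Proof. exact: initial_continuous. Qed.

Lemma expiD (s t : 'rV[R]_n) : expi (s + t) = (expi s * expi t)%g.
Proof. by apply: torus_ext => k; rewrite !mxE; exact: cisD. Qed.

Lemma expi_line_continuous j :
  continuous (fun s : R => expi (s *: delta_mx 0 j : 'rV[R]_n)).
Proof.
apply: continuous_comp_initial => s; apply: continuous_mx => i k /=.
rewrite (_ : (fun y => _) = fun y : R =>
    cis (y * (delta_mx 0 j : 'rV[R]_n) 0 k)); last first.
  by apply/funext => y; rewrite !mxE.
have cm : {for s, continuous (fun y : R => y * (delta_mx 0 j : 'rV[R]_n) 0 k)}.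
  exact: mulrr_continuous.
by apply: Complex_continuous; apply: continuous_comp cm _;
  [exact: continuous_cos|exact: continuous_sin].
Qed.

Lemma aut_line_character (tau : torus_aut R n) k j : exists w : R,
  forall s, \val (tau (expi (s *: delta_mx 0 j))) ord0 k = cis (w * s).
Proof.
pose chi (s : R) : R[i] := \val (tau (expi (s *: delta_mx 0 j))) ord0 k.
have chiD s t : chi (s + t) = chi s * chi t.
  by rewrite /chi scalerDl expiD autM mxE.
have cchi : continuous chi.
  pose line (s : R) : torus R n := expi (s *: delta_mx 0 j).
  change (continuous ((fun M : 'rV[R[i]]_n => M ord0 k) \o
    ((fun u : torus R n => \val u) \o (tau \o line)))).
  move=> s; apply: continuous_comp; last exact: coord_continuous.
  apply: continuous_comp; last exact: torus_val_continuous.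
  apply: continuous_comp; first exact: expi_line_continuous.
  exact: aut_continuous.
have chi1 s : complex.Re (chi s) ^+ 2 + complex.Im (chi s) ^+ 2 = 1.
  have := torusP (tau (expi (s *: delta_mx 0 j))) k.
  rewrite -/(chi s) normc_def => -[] h.
  by rewrite -[LHS]sqr_sqrtr ?addr_ge0 ?sqr_ge0// h expr1n.
have [|||w wP] := @circle_morphism_trig R (fun s => complex.Re (chi s))
                                          (fun s => complex.Im (chi s)).
- by move=> s; apply: continuous_comp; [exact: cchi|exact: Re_continuous].
- by move=> s; apply: continuous_comp; [exact: cchi|exact: Im_continuous].
- split=> // s t /=; rewrite chiD; case: (chi s) (chi t) => a b [c d] //=.
  by rewrite addrC.
exists w => s; have [/= c e] := wP s.
by rewrite -/(chi s) /cis -c -e; case: (chi s).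
Qed.

(** A vector is the sum of its components along the axes, so the character is
    the product of its restrictions to the axes. *)
Lemma aut_character (tau : torus_aut R n) k : exists w : 'I_n -> R,
  forall t : 'rV[R]_n, \val (tau (expi t)) ord0 k = cis (\sum_j w j * t ord0 j).
Proof.
have [w wP] := fin_all_exists (aut_line_character tau k).
exists w => t; rewrite {1}[t]row_sum_delta.
elim: (index_enum _) => [|j s IH]; last first.
  by rewrite !big_cons expiD autM mxE IH wP cisD.
rewrite !big_nil cis0; set z := tau _.
have /(congr1 (fun u : torus R n => \val u ord0 k)) : (z * z)%g = z.
  by rewrite -autM -expiD addr0.
rewrite mxE => /(canRL (mulfK (torus_neq0 z k))).
by rewrite divff ?torus_neq0.
Qed.

End TorusAutomorphisms.

Section SmoothTorusAutomorphisms.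
Context (R : realType).

Lemma Ck_linear (V W : normedModType R) k (U : set V) (l : {linear V -> W}) :
  continuous l -> Ck k U l.
Proof.
move=> cl; case: k => [|k]; first by move=> x _; exact: cl.
split=> [x _|v]; first exact: linear_differentiable.
rewrite (_ : (fun x => _) = cst (l v)); first exact: Ck_cst.
apply/funext => x; rewrite deriveE; last exact: linear_differentiable.
by rewrite diff_lin.
Qed.

Lemma derive_comp_real (V : normedModType R) (f : V -> R) (g dg : R -> R) x v :
  differentiable f x -> is_derive (f x) 1 g (dg (f x)) ->
  differentiable (g \o f) x /\ 'D_v (g \o f) x = dg (f x) * 'D_v f x.
Proof.
move=> df Dg; have dg' : differentiable g (f x) by apply/derivable1_diffP.
have dgf : differentiable (g \o f) x by exact: differentiable_comp.
split=> //; rewrite (deriveE _ dgf) (deriveE _ df) (diff_comp df dg') /=.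
rewrite deriv1E; last exact/derivable1_diffP.
by rewrite derive1E (@derive_val _ _ _ _ _ _ _ Dg) mulrC.
Qed.

(** Cosine and sine are treated together, since each occurs in the derivative
    of the other. *)
Lemma Ck_cos_sin (V : normedModType R) k (U : set V) (f : V -> R) : open U ->
  Ck k U f -> Ck k U (cos \o f) /\ Ck k U (sin \o f).
Proof.
move=> oU; elim: k => [|k IH] Cf.
  by split=> x Ux; apply: continuous_comp; [exact: Cf|exact: continuous_cos|
    exact: Cf|exact: continuous_sin].
have [Cc Cs] := IH (CkW Cf); have [df Df] := Cf.
have dcos x v : U x -> _ :=
  fun Ux => derive_comp_real v (dg := fun y => - sin y)
                             (df x Ux) (is_derive_cos _).
have dsin x v : U x -> _ :=
  fun Ux => derive_comp_real v (dg := cos) (df x Ux) (is_derive_sin _).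
split; split=> [x Ux|v].
- by have [] := dcos x 0 Ux.
- have CN1 : Ck k U (fun=> -1 : R) by exact: Ck_cst.
  apply: Ck_ext (Ck_mul oU Cs (Ck_mul oU CN1 (Df v))) => // x Ux.
  by have [_ ->] := dcos x v Ux; rewrite /= mulN1r mulrN mulNr.
- by have [] := dsin x 0 Ux.
- apply: Ck_ext (Ck_mul oU Cc (Df v)) => // x Ux.
  by have [_ ->] := dsin x v Ux.
Qed.

Lemma Ck_aut_expi n (tau : torus_aut R n) m k :
  Ck m setT (fun t => complex.Re (\val (tau (expi t)) ord0 k)) /\
  Ck m setT (fun t => complex.Im (\val (tau (expi t)) ord0 k)).
Proof.
have [w wP] := aut_character tau k.
pose l (t : 'rV[R]_n) := \sum_j w j * t ord0 j.
have Cl : Ck m setT l.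
  apply: Ck_sum => [|j]; first exact: openT.
  apply: Ck_mul; [exact: openT|exact: Ck_cst|].
  apply: (@Ck_coord _ _ _ _ _ idfun); first exact: openT.
  by apply: (@Ck_linear _ _ _ _ idfun) => x; exact: cvg_id.
have [Cc Cs] := Ck_cos_sin openT Cl.
rewrite (_ : (fun t => complex.Re _) = cos \o l); last first.
  by apply/funext => t; rewrite wP.
rewrite (_ : (fun t => complex.Im _) = sin \o l); last first.
  by apply/funext => t; rewrite wP.
by [].
Qed.

End SmoothTorusAutomorphisms.

(** * Framings *)
Section Framing.
Context (R : realType) (n : nat) (r : option nat) (X : topologicalType).
Variables (A : ws_atlas R n r X) (rho : ws_idx A -> ws_idx A -> torus_aut R n).
Hypothesis rhoA : associated rho.

(** [frame i tau] is the part of the chart [A i] on which [u] is to act as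
    [tau^-1 u] does in the coordinates; the inverse makes the change of charts
    a right multiplication by [rho i j]. *)
Record framing := Framing {
  frame :> ws_idx A -> torus_aut R n -> set X;
  frame_dom : forall i tau, frame i tau `<=` cdom (A i);
  frame_open : forall i tau, open (frame i tau);
  frame_saturated : forall i tau x y,
    frame i tau x -> orbit_map A x = orbit_map A y -> frame i tau y;
  frame_ex : forall i x, cdom (A i) x -> exists tau, frame i tau x;
  frame_uniq : forall i tau tau' x,
    frame i tau x -> frame i tau' x -> tau = tau';
  frame_change : forall i j tau x, frame i tau x -> cdom (A j) x ->
    frame j (tau * rho i j)%g x }.

Lemma rho_cocycle i j k x : cdom (A i) x -> cdom (A j) x -> cdom (A k) x ->
  (rho i j * rho j k = rho i k)%g.
Proof.
move=> Ui Uj Uk; apply: (cocycleP (atlas_cocycle rhoA)).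
by exists (orbit_map A x); split; [split|]; apply/orbit_map_dom.
Qed.

(** Let [a] be the 0-cochain on the refinement [s].  Over the member [k] of the
    refinement the chart [s k] gets the automorphism [a k], and any other chart
    the one that [rho] forces.  That [a] trivializes [rho] says exactly that the
    result does not depend on [k]. *)
Lemma cech_trivial_framing :
  cech_equal (existT _ _ (atlas_cocycle rhoA))
             (existT _ _ (trivial_cocycle (torus_aut R n) (orbit_cover A))) ->
  inhabited framing.
Proof.
move=> [V [s [_ [a /= aP]]]].
have sub k x : V k (orbit_map A x) -> cdom (A (s k)) x.
  by move/(@ref_sub _ _ _ s) => /orbit_map_dom.
have rhoE k l x : V k (orbit_map A x) -> V l (orbit_map A x) ->
    rho (s k) (s l) = ((a k)^-1 * a l)%g.
  move=> Vk Vl; have := aP k l (ex_intro _ (orbit_map A x) (conj Vk Vl)).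
  move/(congr1 (fun g => (a k)^-1 * g * a l)%g).
  by rewrite mulg1 -!mulgA mulVg mulg1 mulKg.
pose F i tau := [set x | cdom (A i) x /\
  exists k, V k (orbit_map A x) /\ tau = (a k * rho (s k) i)%g].
constructor; exists F.
- by move=> i tau x [].
- move=> i tau; rewrite (_ : F i tau = cdom (A i) `&`
      \bigcup_(k in [set k | tau = (a k * rho (s k) i)%g])
        (orbit_map A @^-1` V k)).
    apply: openI; first exact: cdom_open.
    apply: bigcup_open => k _; apply: orbit_map_open_preimage.
    exact: cov_open.
  apply/seteqP; split=> x [Ux [k]].
    by move=> [Vk e]; split=> //; exists k.
  by move=> e Vk; split=> //; exists k.
- move=> i tau x y [Ux [k [Vk e]]] xy; split; last by exists k; rewrite -xy.
  by apply/orbit_map_dom; rewrite -xy; apply/orbit_map_dom.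
- move=> i x Ux.
  have [k _ Vk] : (\bigcup_k V k) (orbit_map A x) by rewrite cov_full.
  by exists (a k * rho (s k) i)%g; split=> //; exists k.
- move=> i tau tau' x [Ux [k [Vk ->]]] [_ [l [Vl ->]]].
  rewrite -(rho_cocycle (sub _ _ Vk) (sub _ _ Vl) Ux) (rhoE k l x Vk Vl).
  by rewrite !mulgA mulgV mul1g.
- move=> i j tau x [Ux [k [Vk ->]]] Uj; split=> //; exists k; split=> //.
  by rewrite -mulgA (rho_cocycle (sub _ _ Vk) Ux Uj).
Qed.

Lemma atlas_equivariant i j u x y : cdom (A i) x -> cdom (A j) x ->
  cdom (A j) y -> A j y = std_act u (A j x) ->
  cdom (A i) y /\ A i y = std_act (rho i j u) (A i x).
Proof.
move=> Ui Uj Vj e; have xy : orbit_map A x = orbit_map A y.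
  by apply/(orbit_map_eqP y Uj); split=> //; exists u.
have Vi : cdom (A i) y by apply/orbit_map_dom; rewrite -xy; apply/orbit_map_dom.
have Oy : overlap (A i) (A j) y by [].
have [_ _ eqv _] := rhoA (ex_intro _ y Oy).
split=> //; rewrite -(transitionE Oy) e eqv; last by exists x.
by rewrite transitionE.
Qed.

End Framing.

Section FramedAction.
Context (R : realType) (n : nat) (r : option nat) (X : topologicalType).
Variables (A : ws_atlas R n r X) (rho : ws_idx A -> ws_idx A -> torus_aut R n).
Hypothesis rhoA : associated rho.
Variable F : framing rho.

Lemma framed_point x : exists i tau, F i tau x.
Proof.
by have [i /(frame_ex F)[tau h]] := atlas_covers A x; exists i, tau.
Qed.

(** The translate is constructed in one chart; the cocycle relation between the
    automorphisms of two charts and the equivariance of the change of charts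
    show that it is the translate prescribed by every other chart. *)
Lemma framed_translate u x : exists y, forall i tau, F i tau x ->
  F i tau y /\ A i y = std_act (aut_inv tau u) (A i x).
Proof.
have [i [tau Fx]] := framed_point x; have Ui := frame_dom Fx.
have [y [Uy oy ey]] := orbit_map_act (aut_inv tau u) Ui.
exists y => j tau' Fx'; split; first exact: frame_saturated Fx' (esym oy).
have Uj := frame_dom Fx'.
have e := frame_uniq Fx' (frame_change Fx Uj).
have [z [Uz oz ez]] := orbit_map_act (aut_inv tau' u) Uj.
have [Viz eiz] := atlas_equivariant rhoA Ui Uj Uz ez.
suff -> : y = z by [].
apply: (chart_inj Uy Viz); rewrite ey eiz; congr std_act.
have : tau' (aut_inv tau' u) = u by rewrite autVK.
move: (aut_inv tau' u) => w; rewrite e => <-.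
exact: (autK tau).
Qed.

Definition framed_act u x : X := projT1 (cid (framed_translate u x)).

Lemma framed_actP u x i tau : F i tau x ->
  F i tau (framed_act u x) /\
  A i (framed_act u x) = std_act (aut_inv tau u) (A i x).
Proof. by rewrite /framed_act; case: cid => y /= h /h. Qed.

Lemma aut1 (tau : torus_aut R n) : tau 1%g = 1%g.
Proof.
have : (tau 1 * tau 1 = tau 1)%g by rewrite -autM mulg1.
by move/(congr1 (fun g => (tau 1)^-1 * g)%g); rewrite mulKg mulVg.
Qed.

Lemma framed_act1 x : framed_act 1%g x = x.
Proof.
have [i [tau Fx]] := framed_point x; have [Fy ey] := framed_actP 1%g Fx.
apply: (chart_inj (frame_dom Fy) (frame_dom Fx)); rewrite ey.
by rewrite -[aut_inv tau]/(aut_fun (aut_inverse tau)) aut1 std_act1.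
Qed.

Lemma framed_actM u v x :
  framed_act (u * v)%g x = framed_act u (framed_act v x).
Proof.
have [i [tau Fx]] := framed_point x; have [Fy ey] := framed_actP (u * v)%g Fx.
have [Fz ez] := framed_actP v Fx; have [Ft et] := framed_actP u Fz.
apply: (chart_inj (frame_dom Fy) (frame_dom Ft)); rewrite ey et ez -std_actM.
by rewrite -![aut_inv tau]/(aut_fun (aut_inverse tau)) autM.
Qed.

(** A small open set around the image of a point lies in one chart, where the
    action is the explicit map [f]. *)
Lemma framed_act_continuous :
  continuous (fun p : torus R n * X => framed_act p.1 p.2).
Proof.
move=> [u0 x0] B /=; rewrite nbhsE => -[D [oD Dx] sDB].
have [i [tau Fx]] := framed_point x0; have [Fy ey] := framed_actP u0 Fx.
pose O := D `&` cdom (A i).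
have oO : open O by apply: openI => //; exact: cdom_open.
have oP : open (A i @` O) by apply: chart_image_open => // y [].
pose f (p : torus R n * X) := std_act (aut_inv tau p.1) (A i p.2).
have cf : {for (u0, x0), continuous f}.
  apply: continuous_mx => k l.
  pose cl (M : 'rV[R[i]]_n) := M ord0 l.
  pose g := (fun v : torus R n => cl (\val v)) \o (aut_inv tau \o fst (B := X)).
  pose h := (cl \o (A i \o snd (A := torus R n))).
  rewrite (_ : (fun y => _) = fun p => g p * h p); last first.
    by apply/funext => p; rewrite mxE.
  have cg : {for (u0, x0), continuous g}.
    apply: continuous_comp.
      by apply: continuous_comp; [exact: cvg_fst|exact: autV_continuous].
    apply: continuous_comp; first exact: torus_val_continuous.
    exact: coord_continuous.
  have ch : {for (u0, x0), continuous h}.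
    apply: continuous_comp; last exact: coord_continuous.
    apply: continuous_comp; [exact: cvg_snd|].
    exact: (chart_continuous_at (frame_dom Fx)).
  exact: continuousM cg ch.
have nP : nbhs (u0, x0) (f @^-1` (A i @` O)).
  apply: cf; apply: open_nbhs_nbhs; split=> //.
  exists (framed_act u0 x0); first by split=> //; exact: frame_dom Fy.
  by rewrite ey.
have nF : nbhs (u0, x0) [set p | F i tau p.2].
  by apply: cvg_snd; apply: open_nbhs_nbhs; split=> //; exact: frame_open.
change (nbhs (u0, x0) [set p | B (framed_act p.1 p.2)]).
apply: filterS (filterI nP nF) => -[u x] [/= [y [Oy Uy] e] Fux].
have [Fv ev] := framed_actP u Fux.
by apply: sDB; rewrite -(chart_inj Uy (frame_dom Fv))// e ev.
Qed.

Definition framed_action : torus_action R n X :=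
  TorusAction framed_act1 framed_actM framed_act_continuous.

End FramedAction.

(** * Restriction of charts *)
Section Restriction.
Context (R : realType) (n : nat).

Lemma Cr_of_Ck (V W V' W' : normedModType R) r (U : set V) (U' : set V')
    (f : V -> W) (g : V' -> W') :
  (forall k, Ck k U f -> Ck k U' g) -> Cr r U f -> Cr r U' g.
Proof. by move=> fg; case: r => [k /fg//|Cf k]; exact/fg/Cf. Qed.

Lemma Cr_sub (V W : normedModType R) r (U U' : set V) (f : V -> W) :
  U' `<=` U -> Cr r U f -> Cr r U' f.
Proof. by move=> sU; apply: Cr_of_Ck => k; exact: Ck_sub. Qed.

Lemma Cr_ext (V W : normedModType R) r (U : set V) (f g : V -> W) : open U ->
  (forall x, U x -> f x = g x) -> Cr r U f -> Cr r U g.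
Proof. by move=> oU fg; apply: Cr_of_Ck => k; exact: Ck_ext. Qed.

Lemma Cr_diffeo_restrict r (U U' V' : set 'rV[R[i]]_n) V f f' :
  Cr_diffeo r U V f -> open U' -> open V' -> U' `<=` U ->
  {in U', f =1 f'} -> V' = f' @` U' -> Cr_diffeo r U' V' f'.
Proof.
move=> [g [[fUV _ _] fK Cf Cg]] oU' oV' sU ff' V'E.
have fE z : U' z -> f' z = f z by move=> Uz; rewrite ff'// inE.
have gK z : U' z -> g (f' z) = z by move=> Uz; rewrite fE// fK// inE; exact: sU.
exists g; split.
- split; first by move=> z Uz; rewrite V'E; exists z.
    by move=> z w /[!inE] Uz Uw e; rewrite -(gK z)// e gK.
  by rewrite V'E => _ [z Uz <-]; exists z.
- by move=> z /[!inE]; exact: gK.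
- apply: (@Cr_ext _ _ _ _ (@realify R n \o f \o @complexify R n)).
  + exact: realify_image_open.
  + by move=> _ [z Uz <-] /=; rewrite realifyK fE.
  + by apply: Cr_sub Cf => _ [z Uz <-]; exists z => //; exact: sU.
- apply: Cr_sub Cg => _ [z Vz <-]; exists z => //.
  by move: Vz; rewrite V'E => -[w Uw <-]; rewrite fE//; apply: fUV; exact: sU.
Qed.

Lemma Cr_diffeo_set0 r f : Cr_diffeo r set0 set0 (f : 'rV[R[i]]_n -> _).
Proof.
have C0 g : Cr r ((@realify R n) @` set0)
                 (@realify R n \o g \o @complexify R n).
  rewrite image_set0.
  have C (k : nat) (h : 'rV[R]_(n + n) -> 'rV[R]_(n + n)) : Ck k set0 h.
    by elim: k h => [|k IH] h //=.
  by case: r => [k|] /= => [|k]; exact: C.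
exists f; split=> //; last by move=> z /[!inE].
by split=> // z w /[!inE].
Qed.

Context (r : option nat) (X : topologicalType).
Variables (A : ws_atlas R n r X) (rho : ws_idx A -> ws_idx A -> torus_aut R n).
Hypothesis rhoA : associated rho.

(** The last clause keeps the image of the restricted chart invariant under the
    torus. *)
Definition restricts (c : chart R n X) i :=
  [/\ cfun c = A i, open (cdom c), cdom c `<=` cdom (A i) &
      forall x y, cdom c x -> orbit_map A x = orbit_map A y -> cdom c y].

Lemma restricts_self i : restricts (A i) i.
Proof.
split=> //; first exact: cdom_open.
by move=> x y Ux e; apply/orbit_map_dom; rewrite -e; apply/orbit_map_dom.
Qed.

Lemma restricts_is_chart c i : restricts c i -> is_chart c.
Proof.
move=> [cE oc sc _]; have oV : open (cimg c).
  by rewrite /cimg cE; exact: chart_image_open.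
split=> //; split.
- split; first by move=> x Ux; exists x.
    move=> x y /[!inE] Ux Uy; rewrite cE.
    by apply: chart_inj; exact: sc.
  by move=> z.
- rewrite continuous_open_subspace// cE => x /[!inE] Ux.
  exact: (chart_continuous_at (sc _ Ux)).
have [_ _ [_ _ [g gc gP]]] := @ws_is_chart _ _ _ _ A i.
have sV (z : set_type (cimg c)) : \val z \in cimg (A i).
  case: z => z /=; rewrite !inE /cimg cE => -[x Ux <-].
  by exists x => //; exact: sc.
pose incl (z : set_type (cimg c)) : set_type (cimg (A i)) :=
  exist _ (\val z) (sV z).
have cincl : continuous incl.
  by apply: continuous_comp_initial; exact: initial_continuous.
exists (g \o incl).
  by move=> z; apply: continuous_comp; [exact: cincl|exact: gc].
move=> z /=; have [Ug eg] := gP (incl z); rewrite cE; split=> //.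
have [x Ux e] : cimg c (\val z) by case: (z) => z0 /= /[!inE].
suff -> : g (incl z) = x by [].
by apply: (chart_inj Ug (sc _ Ux)); rewrite eg -cE e.
Qed.

Lemma restricts_Cr_diffeo c d i j : restricts c i -> restricts d j ->
  Cr_diffeo r (d @` overlap c d) (c @` overlap c d) (transition c d).
Proof.
move=> rc rd; have [cE oc sc _] := rc; have [dE od sd _] := rd.
have sO : overlap c d `<=` overlap (A i) (A j) by move=> x [/sc + /sd].
have [->|/set0P[x Ox]] := eqVneq (overlap c d) set0.
  by rewrite !image_set0; exact: Cr_diffeo_set0.
have oO : open (overlap c d) by exact: openI.
have tE y : overlap c d y -> transition c d (d y) = c y.
  by apply: transition_chart; exact: restricts_is_chart rd.
have [_ _ _ dO] := rhoA (ex_intro _ x (sO x Ox)).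
apply: Cr_diffeo_restrict dO _ _ _ _ _.
- by rewrite dE; apply: chart_image_open => // y [_ /sd].
- by rewrite cE; apply: chart_image_open => // y [/sc].
- by rewrite dE => _ [y Oy <-]; exists y => //; exact: sO.
- move=> _ /[!inE] -[y Oy <-].
  by rewrite (tE y Oy) dE transitionE ?cE//; exact: sO.
- apply/seteqP; split=> [_ [y Oy <-]|_ [_ [y Oy <-] <-]].
    by exists (d y); [exists y|exact: tE].
  by exists y => //; rewrite tE.
Qed.

Lemma restricts_equivariant c d i j : restricts c i -> restricts d j ->
  overlap c d !=set0 -> equivariant_diffeo r (rho i j) c d.
Proof.
move=> rc rd [x Ox]; have [cE oc sc satc] := rc; have [dE od sd satd] := rd.
have satO y z : overlap c d y -> orbit_map A y = orbit_map A z -> overlap c d z.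
  by move=> [cy dy] e; split; [exact: satc cy e|exact: satd dy e].
have tE y : overlap c d y -> transition c d (d y) = c y.
  by apply: transition_chart; exact: restricts_is_chart rd.
have inv k e : cfun e = A k -> cdom e `<=` cdom (A k) ->
    overlap c d `<=` cdom e -> torus_invariant (e @` overlap c d).
  move=> eE se sO u _ [y Oy <-].
  have [z [Uz oz ez]] := orbit_map_act u (se _ (sO _ Oy)).
  by exists z; [exact: satO Oy (esym oz)|rewrite eE ez].
split; [| | |exact: restricts_Cr_diffeo rc rd].
- by apply: (inv i) => // y [].
- by apply: (inv j) => // y [].
move=> u _ [y Oy <-]; have [cy dy] := Oy.
have [z [Uz oz ez]] := orbit_map_act u (sd _ dy).
have [Ui ei] := atlas_equivariant rhoA (sc _ cy) (sd _ dy) Uz ez.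
by rewrite (tE y Oy) dE -ez -dE tE ?cE ?ei//; exact: satO Oy (esym oz).
Qed.

End Restriction.

(** * The standard atlas of a framing *)
Section StandardAtlas.
Context (R : realType) (n : nat) (r : option nat) (X : topologicalType).
Variables (A : ws_atlas R n r X) (rho : ws_idx A -> ws_idx A -> torus_aut R n).
Hypothesis rhoA : associated rho.
Variable F : framing rho.

Definition framed_chart (p : ws_idx A * torus_aut R n) : chart R n X :=
  Chart (F p.1 p.2) (A p.1).

Lemma framed_restricts p : restricts (A := A) (framed_chart p) p.1.
Proof.
by split=> //=; [exact: frame_open|exact: frame_dom|exact: frame_saturated].
Qed.

Lemma framed_cover : \bigcup_p cdom (framed_chart p) = setT.
Proof.
apply/seteqP; split=> // x _; have [i [tau Fx]] := framed_point F x.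
by exists (i, tau).
Qed.

Lemma framed_is_chart p : is_chart (framed_chart p).
Proof. exact: restricts_is_chart (framed_restricts p). Qed.

Lemma framed_invariant p : torus_invariant (cimg (framed_chart p)).
Proof.
move=> u _ [x Fx <-].
have [y [Uy oy ey]] := orbit_map_act u (frame_dom Fx).
by exists y => //; exact: frame_saturated Fx (esym oy).
Qed.

Lemma framed_compatible p q :
  overlap (framed_chart p) (framed_chart q) !=set0 ->
  exists sigma, equivariant_diffeo r sigma (framed_chart p) (framed_chart q).
Proof.
move=> pq; exists (rho p.1 q.1).
by apply: restricts_equivariant pq => //; exact: framed_restricts.
Qed.

(** The pieces of one chart are disjoint.  Two different charts of [A] have a
    connected overlap, and on it the automorphism of the first chart is locally
    constant and determines that of the second: a nonempty overlap of pieces is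
    the whole overlap of the charts. *)
Lemma framed_connected p q : p != q ->
  connected (overlap (framed_chart p) (framed_chart q)).
Proof.
case: p q => [i tau] [j tau'] pq; set O := overlap _ _.
have [->|/set0P[x [Fi Fj]]] := eqVneq O set0; first exact: connected0.
have ij : i != j.
  apply: contra_neq pq => ij; subst j.
  by congr pair; exact: frame_uniq Fi Fj.
suff -> : O = overlap (A i) (A j) by exact: ws_connected.
have Cij := ws_connected ij.
have tau'E : tau' = (tau * rho i j)%g.
  exact: frame_uniq Fj (frame_change Fi (frame_dom Fj)).
apply: Cij.
- by exists x.
- exists (F i tau `&` F j tau'); first by apply: openI; exact: frame_open.
  apply/seteqP; split=> y; last by case.
  move=> [Fy Fy']; split=> //.
  by split; [exact: frame_dom Fy|exact: frame_dom Fy'].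
exists (~` \bigcup_(s in [set s | s != tau]) F i s).
  by rewrite closedC; apply: bigcup_open => s _; exact: frame_open.
apply/seteqP; split=> y.
  move=> [Fy Fy']; split.
    by split; [exact: frame_dom Fy|exact: frame_dom Fy'].
  by move=> [s /eqP st Fs]; apply: st; exact: frame_uniq Fs Fy.
move=> [[Ui Uj] nF]; have [s Fs] := frame_ex F Ui.
have st : s = tau by apply/eqP; apply: contra_notT nF => st; exists s.
subst s; split=> //=; rewrite tau'E; exact: frame_change.
Qed.

Definition framed_atlas : ws_atlas R n r X :=
  @WsAtlas _ _ r X (ws_idx A * torus_aut R n)%type framed_chart framed_cover
    framed_is_chart framed_invariant framed_connected framed_compatible.

Lemma framed_atlas_equiv : atlas_equiv A framed_atlas.
Proof.
move=> i p ip; exists (rho i p.1); apply: restricts_equivariant ip => //.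
  exact: restricts_self.
exact: framed_restricts.
Qed.

Lemma atlas_Cr_structure : Cr_structure r A.
Proof.
split; [exact: ws_cover|exact: ws_is_chart|move=> i j].
exact: (restricts_Cr_diffeo rhoA (restricts_self i) (restricts_self j)).
Qed.

Lemma framed_standard : standard_atlas (r := r) A (framed_action rhoA F)
  (fun p : ws_idx framed_atlas => aut_inverse p.2).
Proof.
move=> p; split.
- by move=> u x /= Fx; have [] := framed_actP rhoA u Fx.
- by move=> u x /= Fx; have [] := framed_actP rhoA u Fx.
move=> k.
exact: (restricts_Cr_diffeo rhoA (framed_restricts p) (restricts_self k)).
Qed.

Lemma realify_act_l (u : torus R n) (y : 'rV[R]_(n + n)) m :
  realify (std_act u (complexify y)) ord0 (lshift n m) =
  complex.Re (\val u ord0 m) * y ord0 (lshift n m) -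
  complex.Im (\val u ord0 m) * y ord0 (rshift n m).
Proof. by rewrite /realify row_mxEl !mxE; case: (\val u ord0 m). Qed.

Lemma realify_act_r (u : torus R n) (y : 'rV[R]_(n + n)) m :
  realify (std_act u (complexify y)) ord0 (rshift n m) =
  complex.Re (\val u ord0 m) * y ord0 (rshift n m) +
  complex.Im (\val u ord0 m) * y ord0 (lshift n m).
Proof. by rewrite /realify row_mxEr !mxE; case: (\val u ord0 m). Qed.

(** On the open set [D tau] of the pairs [(t, y)] such that [y] represents a
    point of [frame i tau], the action is [tau^-1 (exp (i t))] applied to [T y],
    with [T] the change of charts.  Its coordinates are bilinear in the real and
    imaginary parts of the two factors, and each factor depends on one variable
    only. *)
Lemma framed_Ck_action k i j :
  Ck k ((@realify R n) @` (A j @` overlap (A i) (A j)))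
    (@realify R n \o transition (A i) (A j) \o @complexify R n) ->
  Ck k [set p : 'rV[R]_n * 'rV[R]_(n + n) | exists x,
      [/\ cdom (A j) x, cdom (A i) (framed_action rhoA F (expi p.1) x) &
          A j x = complexify p.2]]
    (fun p => realify (local_rep (A i) (A j)
       (framed_action rhoA F (expi p.1)) (complexify p.2))).
Proof.
set T := (_ \o _ \o _) => CT.
pose O tau := F i tau `&` cdom (A j).
pose U tau := (@realify R n) @` (A j @` O tau).
have oO tau : open (O tau).
  by apply: openI; [exact: frame_open|exact: cdom_open].
have oU tau : open (U tau).
  by apply: realify_image_open; apply: chart_image_open => // x [].
pose D tau := (snd : 'rV[R]_n * 'rV[R]_(n + n) -> _) @^-1` U tau.
have csnd : continuous (snd : 'rV[R]_n * 'rV[R]_(n + n) -> 'rV[R]_(n + n)).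
  by move=> p; exact: cvg_snd.
have cfst : continuous (fst : 'rV[R]_n * 'rV[R]_(n + n) -> 'rV[R]_n).
  by move=> p; exact: cvg_fst.
have oD tau : open (D tau) by move/continuousP: csnd; apply.
have DP tau p : D tau p -> exists2 x, O tau x & A j x = complexify p.2.
  by move=> [_ [x Ox <-] e]; exists x => //; rewrite -e realifyK.
apply: (@Ck_sub _ _ _ _ (\bigcup_tau D tau)).
  (* The translate of [x] lies in [A i], hence so does [x]. *)
  move=> p [x [Uj Ui e]].
  have [s Fs] := frame_ex F Uj; have [Fy ey] := framed_actP rhoA (expi p.1) Fs.
  exists (s * rho j i)%g => //; exists (A j x); last by rewrite e complexifyK.
  exists x => //; split=> //; apply: frame_saturated (frame_change Fy Ui) _.
  apply/esym/(orbit_map_eqP _ Uj); split; first exact: frame_dom Fy.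
  by exists (aut_inv s (expi p.1)).
apply: Ck_bigcup => tau _.
pose w (p : 'rV[R]_n * 'rV[R]_(n + n)) := \val (aut_inverse tau (expi p.1)).
pose Phi p :=
  realify (std_act (aut_inverse tau (expi p.1)) (complexify (T p.2))).
apply: (@Ck_ext _ _ _ _ _ Phi) => // [p /DP[x [Fx Uj] e]|].
  have [Fy ey] := framed_actP rhoA (expi p.1) Fx.
  rewrite /Phi -e local_rep_chart//; [|exact: ws_is_chart|exact: frame_dom Fy].
  rewrite [framed_action _ _ _ _]/(framed_act _ _ _ _) ey.
  rewrite /T /= realifyK -e transitionE//; split=> //; exact: frame_dom Fx.
have CTp l : Ck k (D tau) (fun p => T p.2 ord0 l).
  have CT' : Ck k (U tau) T.
    apply: Ck_sub CT => _ [z [x [Fx Uj] <-] <-]; exists (A j x) => //.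
    by exists x => //; split=> //; exact: frame_dom Fx.
  apply: (@Ck_coord _ _ _ _ _ (T \o snd)) => //.
  exact: (Ck_linear_pre (l := snd) csnd (oU tau) CT').
have Cw l : Ck k (D tau) (fun p => complex.Re (w p ord0 l)) /\
   Ck k (D tau) (fun p => complex.Im (w p ord0 l)).
  have [CRe CIm] := Ck_aut_expi (aut_inverse tau) k l.
  split.
    by apply: Ck_sub (Ck_linear_pre (l := fst) cfst openT CRe).
  by apply: Ck_sub (Ck_linear_pre (l := fst) cfst openT CIm).
have CN1 : Ck k (D tau) (fun=> -1 : R) by exact: Ck_cst.
apply: Ck_row => // l; case: (split_ordP l) => m ->.
  have [CRe CIm] := Cw m.
  apply: Ck_ext (Ck_add (oD tau) (Ck_mul (oD tau) CRe (CTp (lshift n m)))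
    (Ck_mul (oD tau) CN1 (Ck_mul (oD tau) CIm (CTp (rshift n m))))) => // p _.
  by rewrite /Phi realify_act_l mulN1r.
have [CRe CIm] := Cw m.
apply: Ck_ext (Ck_add (oD tau) (Ck_mul (oD tau) CRe (CTp (rshift n m)))
  (Ck_mul (oD tau) CIm (CTp (lshift n m)))) => // p _.
by rewrite /Phi realify_act_r.
Qed.

Lemma framed_Cr_action : Cr_action r A (framed_action rhoA F).
Proof.
move=> i j; have [_ _ /(_ i j)[_ [_ _ CT _]]] := atlas_Cr_structure.
by apply: Cr_of_Ck CT => k; exact: framed_Ck_action.
Qed.

End StandardAtlas.

(** * The criterion *)

Lemma atlas_class_eq (R : realType) n r (X : topologicalType)
    (A B : ws_atlas R n r X) :
  atlas_class A B -> atlas_class A = atlas_class B.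
Proof.
move=> AB; apply/funext => C; apply/propext; split; last exact: rst_trans AB.
by apply: rst_trans; apply: rst_sym.
Qed.

Theorem proposition3p5 (R : realType) (n : nat) (r : option nat)
    (X : topologicalType) (Xcompact : compact [set: X])
    (Xhausdorff : hausdorff_space X)
    (TT : ws_atlas R n r X -> Prop) (TTloc : local_torus_action TT)
    (A : ws_atlas R n r X) (TTA : TT A)
    (rho : ws_idx A -> ws_idx A -> torus_aut R n) (rhoA : associated rho) :
  (exists (I : Type) (M : I -> chart R n X) (a : torus_action R n X),
     [/\ Cr_structure r M, Cr_action r M a, locally_standard r M a &
         induced_by TT M a]) <->
  cech_class (atlas_cocycle rhoA) =
  cech_class (trivial_cocycle (torus_aut R n) (orbit_cover A)).
Proof.
have {TTloc TTA} -> : TT = atlas_class A.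
  by case: TTloc TTA => A0 -> /atlas_class_eq.
rewrite cech_class_eqP; split.
  move=> [I [M [a [_ _ _ [S [sigma [std AS]]]]]]].
  apply: (@induced_cocycle_trivial _ _ _ _ _ _ rhoA S sigma a).
    by rewrite AS; exact: rst_refl.
  by move=> i u x Ux; have [inv eqv _] := std i; split; [exact: inv|exact: eqv].
move=> /cech_trivial_framing[F].
have AS : atlas_class A (framed_atlas rhoA F).
  by apply: rst_step; exact: framed_atlas_equiv.
exists (ws_idx A), A, (framed_action rhoA F); split.
- exact: atlas_Cr_structure rhoA.
- exact: framed_Cr_action.
- exists (framed_atlas rhoA F), (fun p => aut_inverse p.2).
  exact: framed_standard.
- exists (framed_atlas rhoA F), (fun p => aut_inverse p.2).
  by split; [exact: framed_standard|exact: atlas_class_eq].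
Qed.
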